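(* Let $a,b\in\mathbb{R}^2$ be arbitrary points. For every point set $P=\{p_1,\dots,p_n\}\subset\mathbb{R}^2$ ($n\ge3$) in general position, the choice $f_{ij}=\det(a,p_i,p_j)\det(b,p_i,p_j)$ is valid for $P$; i.e. the polyhedron $\bar X_f(P)$ is a simple $(2n-3)$-dimensional polyhedron and $K\mapsto E(K)$ is an inclusion-reversing bijection from the nonempty faces of $\bar X_f(P)$ to the pointed non-crossing graphs embedded on $P$.
   Context: General position: no three points collinear. $\det(q_0,q_1,q_2)$ denotes the determinant of the $3\times3$ matrix with columns $(q_0,1),(q_1,1),(q_2,1)$. Graphs embedded on $P$ have straight-segment edges; non-crossing means edges meet only at common endpoints; a graph is pointed at a vertex $p$ if some angle at $p$ between consecutive incident edges exceeds $\pi$, and pointed if pointed at all vertices. Infinitesimal motions $v\in(\mathbb{R}^2)^n$ are normalized by $v_1^1=v_1^2=v_2^1=0$ (with $p_1,p_2$ having different $y$-coordinates). $\bar X_f(P)$ is the set of normalized $v$ with $\langle p_i-p_j,v_i-v_j\rangle\ge f_{ij}$ for all $i<j$; for a face $K$, $E(K)$ is the set of pairs $ij$ whose inequality is tight on all of $K$. A choice $f$ is called valid for $P$ if $K\mapsto E(K)$ is an inclusion-reversing bijection between nonempty faces of $\bar X_f(P)$ and pointed non-crossing graphs on $P$. *)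

(* Defs.v *)
From mathcomp Require Import all_boot all_order all_algebra.
From mathcomp Require Import boolp reals.
Set Implicit Arguments. Unset Strict Implicit. Unset Printing Implicit Defensive.
Import Order.TTheory GRing.Theory Num.Theory.
Local Open Scope ring_scope.

Section Defs.
Variable R : realType.

Definition pt := (R * R)%type.

Definition ptadd (x y : pt) : pt := (x.1 + y.1, x.2 + y.2).
Definition ptscale (t : R) (x : pt) : pt := (t * x.1, t * x.2).
Definition ptsub (x y : pt) : pt := (x.1 - y.1, x.2 - y.2).
Definition dotp (x y : pt) : R := x.1 * y.1 + x.2 * y.2.

(* det(q0,q1,q2) = det of the 3x3 matrix with columns (q0,1),(q1,1),(q2,1),
   expanded along the last row *)
Definition det3 (q0 q1 q2 : pt) : R :=
  q0.1 * (q1.2 - q2.2) - q1.1 * (q0.2 - q2.2) + q2.1 * (q0.2 - q1.2).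

Variable n : nat.
Variable P : 'I_n -> pt.

Definition general_position : Prop :=
  forall i j k : 'I_n, i != j -> j != k -> i != k -> det3 (P i) (P j) (P k) != 0.

Definition motion := ('I_n -> pt).

(* normalization v_1^1 = v_1^2 = v_2^1 = 0 (p_1, p_2 are the indices 0, 1) *)
Definition normalized (v : motion) : Prop :=
  forall i : 'I_n,
    (val i = 0%N -> (v i).1 = 0 /\ (v i).2 = 0) /\ (val i = 1%N -> (v i).1 = 0).

Definition tight (f : 'I_n -> 'I_n -> R) (i j : 'I_n) (v : motion) : Prop :=
  dotp (ptsub (P i) (P j)) (ptsub (v i) (v j)) = f i j.

Definition Xbar (f : 'I_n -> 'I_n -> R) (v : motion) : Prop :=
  normalized v /\
  forall i j : 'I_n, (i < j)%N ->
    f i j <= dotp (ptsub (P i) (P j)) (ptsub (v i) (v j)).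

Definition lin (c v : motion) : R := \sum_(i < n) dotp (c i) (v i).

(* faces of a polyhedron X: intersections of X with a supporting
   (weakly valid) linear inequality; c = 0, delta = 0 gives X itself *)
Definition face (X K : motion -> Prop) : Prop :=
  exists (c : motion) (delta : R),
    (forall v, X v -> delta <= lin c v) /\
    (forall v, K v <-> (X v /\ lin c v = delta)).

Definition nonempty (K : motion -> Prop) : Prop := exists v, K v.

Definition subset_m (K K' : motion -> Prop) : Prop := forall v, K v -> K' v.

Definition Eof (f : 'I_n -> 'I_n -> R) (K : motion -> Prop) : {set 'I_n * 'I_n} :=
  [set e : 'I_n * 'I_n | (e.1 < e.2)%N && `[< forall v, K v -> tight f e.1 e.2 v >]].

Definition aff_indep (k : nat) (x : 'I_k -> motion) : Prop :=
  forall c : 'I_k -> R,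
    \sum_(l < k) c l = 0 ->
    (forall i : 'I_n, \sum_(l < k) c l * (x l i).1 = 0 /\
                      \sum_(l < k) c l * (x l i).2 = 0) ->
    forall l, c l = 0.

Definition affdim (S : motion -> Prop) (d : nat) : Prop :=
  (exists x : 'I_d.+1 -> motion, (forall l, S (x l)) /\ aff_indep x) /\
  ~ (exists x : 'I_d.+2 -> motion, (forall l, S (x l)) /\ aff_indep x).

Definition simple_polyhedron (X : motion -> Prop) (d : nat) : Prop :=
  affdim X d /\
  forall Vx, face X Vx -> affdim Vx 0 ->
    exists g : 'I_d -> (motion -> Prop),
      injective g /\
      forall F, (face X F /\ affdim F d.-1 /\ subset_m Vx F) <-> exists l, F = g l.

Definition graph_wf (G : {set 'I_n * 'I_n}) : Prop :=
  forall e, e \in G -> (e.1 < e.2)%N.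

Definition on_segment (x a b : pt) : Prop :=
  exists t : R, 0 <= t <= 1 /\ x = ptadd (ptscale (1 - t) a) (ptscale t b).

Definition noncrossing (G : {set 'I_n * 'I_n}) : Prop :=
  forall e e', e \in G -> e' \in G -> e != e' ->
    forall x, on_segment x (P e.1) (P e.2) -> on_segment x (P e'.1) (P e'.2) ->
      (x = P e.1 \/ x = P e.2) /\ (x = P e'.1 \/ x = P e'.2).

Definition adjacent (G : {set 'I_n * 'I_n}) (i j : 'I_n) : Prop :=
  (i, j) \in G \/ (j, i) \in G.

(* pointed at p_i: some angle between consecutive incident edges exceeds pi,
   i.e. all incident edges lie in an open half-plane bounded by a line
   through p_i (vacuous for vertices of degree <= 1). *)
Definition pointed_at (G : {set 'I_n * 'I_n}) (i : 'I_n) : Prop :=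
  exists u : pt, forall j, adjacent G i j -> 0 < dotp u (ptsub (P j) (P i)).

Definition pointed (G : {set 'I_n * 'I_n}) : Prop := forall i, pointed_at G i.

Definition pointed_noncrossing (G : {set 'I_n * 'I_n}) : Prop :=
  graph_wf G /\ noncrossing G /\ pointed G.

Definition valid (f : 'I_n -> 'I_n -> R) : Prop :=
  (forall K, face (Xbar f) K -> nonempty K -> pointed_noncrossing (Eof f K)) /\
  (forall G, pointed_noncrossing G ->
     exists K, face (Xbar f) K /\ nonempty K /\ Eof f K = G) /\
  (forall K K', face (Xbar f) K -> nonempty K -> face (Xbar f) K' -> nonempty K' ->
     (subset_m K K' <-> Eof f K' \subset Eof f K)).

End Defs.

(* Main.v *)
Require Import Defs.
From mathcomp Require Import all_boot all_order all_algebra.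
From mathcomp Require Import boolp reals.
From mathcomp Require Import ring lra zify.
Set Implicit Arguments. Unset Strict Implicit. Unset Printing Implicit Defensive.
Import Order.TTheory GRing.Theory Num.Theory.
Local Open Scope ring_scope.

(* The choices of [a] and [b] give translates of one polyhedron, so near a point
   [x] one may take [f_ij = det(x,p_i,p_j)^2].  Testing a motion of the
   polyhedron against the self-stress [w_ij = l_i l_j] of an affine dependency
   [l] then shows that the tight edges of any feasible motion neither cross nor
   form a non-pointed star.

   A self-stress of the complete graph whose negative edges, and whose positive
   edges, each lie in a pointed non-crossing graph vanishes: its Airy
   (Maxwell-Cremona) function is piecewise linear with compact support, convex
   away from the negative edges, and a positive maximum would force a
   non-pointed vertex of negative edges.  Hence tight sets are independent, the
   polyhedron is simple, and its faces are determined by their tight sets.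

   To realise a pointed non-crossing graph [G], minimise the total slack over
   [G].  The difference between the indicator of [G] and the multipliers at an
   optimum is a self-stress as above, so [G] is tight there; by independence
   the surplus tight edges can be released. *)

(** * Piecewise linear functions of one variable *)

(** The squares come from recentring: seen from [x], [det(a,p,q)] is [det(x,p,q)] plus a term linear
    in [p - q], and what the product adds to the square is the expansion of a quadratic vector
    field. The square vanishes when [x] is collinear with the pair. Hence placing [x] at a crossing,
    or at the centre of a star, silences the tight edges involved, while general position keeps
    another term strictly positive.

    The vanishing theorem has to treat the two signs separately. When [G] is realised, positive
    weights lie on [G] and negative ones on the tight graph of the optimum, and edges of these two
    graphs may cross each other. There is thus no planar subdivision to lift; the Airy function is
    defined without faces, as a sum over the edges crossing a ray, and studied only along lines,
    between successive negative edges.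

    Independence of tight rows also drives the optimisation: any single tight inequality can be
    released on its own, so a negative multiplier would contradict minimality. *)

Ltac split_max := rewrite ?maxEle;
  repeat match goal with |- context [if (?x <= ?y) then _ else _] =>
    case: (lerP x y) => ? /= end.

Lemma small_scale (R : realType) (K : finType) (a b : K -> R) :
  exists2 e : R, 0 < e & forall k, a k != 0 -> e * `|b k| < `|a k|.
Proof.
pose F k := (`|b k| + 1) / `|a k|.
have F_ge0 k : 0 <= F k by rewrite divr_ge0 // addr_ge0.
pose s := 1 + \sum_k F k.
have s_gt0 : 0 < s by rewrite ltr_pwDl // sumr_ge0.
exists s^-1; first by rewrite invr_gt0.
move=> k ak; rewrite mulrC ltr_pdivrMr //.
have Fs : F k < s.
  rewrite /s (bigD1 k) //= addrCA ltrDl ltr_pwDl // sumr_ge0 //.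
have a_gt0 : 0 < `|a k| by rewrite normr_gt0.
apply: lt_le_trans (ler_wpM2l (ltW a_gt0) (ltW Fs)).
by rewrite /F mulrC divfK ?normr_eq0 // ltrDl.
Qed.

Lemma max0_convex (R : realType) (u v A1 A0 A2 : R) :
  0 <= u -> 0 <= v -> (u + v) * A0 = u * A1 + v * A2 ->
  (u + v) * Num.max 0 A0 <= u * Num.max 0 A1 + v * Num.max 0 A2.
Proof.
move=> u0 v0 E; rewrite maxr_pMr ?addr_ge0 // mulr0 E ge_max.
have m0 (x : R) : 0 <= Num.max 0 x by rewrite le_max lexx.
rewrite addr_ge0 ?mulr_ge0 //=.
by rewrite lerD // ler_wpM2l // le_max lexx orbT.
Qed.

Lemma max0_affine (R : realType) (u v A1 A0 A2 : R) :
  0 <= u -> 0 <= v -> (u + v) * A0 = u * A1 + v * A2 ->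
  0 <= A1 /\ 0 <= A2 \/ A1 <= 0 /\ A2 <= 0 ->
  (u + v) * Num.max 0 A0 = u * Num.max 0 A1 + v * Num.max 0 A2.
Proof.
move=> u0 v0 E; rewrite maxr_pMr ?addr_ge0 // mulr0 E => -[] [h1 h2].
  by rewrite !max_r // addr_ge0 // mulr_ge0.
rewrite [Num.max 0 A1]max_l // [Num.max 0 A2]max_l // !mulr0 addr0 max_l //.
by rewrite -oppr_ge0 opprD -!mulrN addr_ge0 // mulr_ge0 // oppr_ge0.
Qed.

Section PiecewiseLinear.
Variables (R : realType) (K : finType) (c a b : K -> R).

(** The form taken by the Airy function along a line: a sum of hinges, the [k]-th bending at
    [s = a k / b k]. *)
Definition pwl (s : R) : R := \sum_k c k * Num.max 0 (a k - s * b k).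

(** A second difference at 0 with a step too short to reach any other breakpoint sees only the
    hinges that bend at 0, each with slope jump [|b k|]. *)
Lemma pwl_kink : (forall s, pwl s = 0) -> \sum_(k | a k == 0) c k * `|b k| = 0.
Proof.
move=> pwl0; have [e e_gt0 eP] := small_scale a b.
have E : pwl e + pwl (- e) - 2 * pwl 0
         = e * \sum_(k | a k == 0) c k * `|b k|.
  rewrite /pwl [in RHS]big_mkcond /= !mulr_sumr -big_split -sumrB /=.
  apply: eq_bigr => k _.
  have ring0 (A B C D : R) : A + B - 2 * C = D -> c k * A + c k * B - 2 * (c k * C) = c k * D.
    by move=> <-; ring.
  case: eqP => [->|/eqP ak].
    rewrite [RHS]mulrCA; apply: ring0; rewrite !sub0r mulNr opprK mul0r oppr0.
    have [hb|hb] := ger0P (b k).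
      have : 0 <= e * b k by rewrite mulr_ge0 // ltW.
      by move: (e * b k) => x ?; split_max; lra.
    have : e * b k < 0 by rewrite pmulr_rlt0.
    by rewrite mulrN; move: (e * b k) => x ?; split_max; lra.
  have := eP _ ak; rewrite -{1}(gtr0_norm e_gt0) -normrM mulNr mul0r.
  rewrite mulr0 -[RHS](mulr0 (c k)); move: (e * b k) => x xa; apply: ring0.
  move: xa; have [ha|ha] := ger0P (a k); rewrite ltr_norml => /andP[h1 h2].
    rewrite [Num.max 0 (a k - x)]max_r ?[Num.max 0 (a k - - x)]max_r;
      by rewrite ?[Num.max 0 (a k - 0)]max_r; lra.
  rewrite [Num.max 0 (a k - x)]max_l ?[Num.max 0 (a k - - x)]max_l;
    by rewrite ?[Num.max 0 (a k - 0)]max_l; lra.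
move: E; rewrite !pwl0 => /esym/eqP; rewrite mulr0 subr0 addr0 mulf_eq0.
by rewrite gt_eqF //= => /eqP.
Qed.

(** Hinges with nonnegative coefficient are convex; those with negative coefficient are affine here,
    their breakpoint [a k / b k] being outside the open interval. *)
Lemma pwl_convex s1 s0 s2 : s1 <= s0 -> s0 <= s2 ->
  (forall k, c k < 0 ->
     b k != 0 /\ forall s, s1 < s -> s < s2 -> a k <> s * b k) ->
  (s2 - s1) * pwl s0 <= (s2 - s0) * pwl s1 + (s0 - s1) * pwl s2.
Proof.
move=> s10 s02 bad; rewrite /pwl !mulr_sumr -big_split /=.
apply: ler_sum => k _; rewrite ![_ * (c k * _)]mulrCA -mulrDr.
have -> : s2 - s1 = (s2 - s0) + (s0 - s1) by ring.
have u0 : 0 <= s2 - s0 by rewrite subr_ge0.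
have v0 : 0 <= s0 - s1 by rewrite subr_ge0.
have E : ((s2 - s0) + (s0 - s1)) * (a k - s0 * b k) =
  (s2 - s0) * (a k - s1 * b k) + (s0 - s1) * (a k - s2 * b k) by ring.
have [ck|ck] := lerP 0 (c k).
  by rewrite ler_wpM2l // max0_convex.
have [bk noz] := bad k ck.
rewrite (max0_affine u0 v0 E) //.
have kink : a k / b k <= s1 \/ s2 <= a k / b k.
  case: (lerP (a k / b k) s1) => h1; first by left.
  case: (lerP s2 (a k / b k)) => h2; first by right.
  by case: (noz _ h1 h2); rewrite divfK.
have ae : a k = (a k / b k) * b k by rewrite divfK.
move: kink ae; move: (a k / b k) => z kink ->.
have s12 := le_trans s10 s02.
by rewrite -!mulrBl; case: (ltrgt0P (b k)) bk => // hb _; case: kink => hz;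
  [right | left | left | right];
  split; rewrite ?(pmulr_lge0 _ hb) ?(pmulr_lle0 _ hb) ?(nmulr_lge0 _ hb)
    ?(nmulr_lle0 _ hb) ?subr_ge0 ?subr_le0 //; lra.
Qed.

(** [B] is only a fallback for the case where no negative term bends on the positive side; otherwise
    [s] is the first such breakpoint, possibly beyond [B]. *)
Lemma next_kink (B : R) : 0 < B ->
  exists2 s, 0 < s &
    (s = B \/ exists2 k, c k < 0 & a k = s * b k) /\
    forall k, c k < 0 -> b k != 0 -> forall t, 0 < t -> t < s -> a k <> t * b k.
Proof.
move=> B_gt0; pose A k := (c k < 0) && (0 < a k / b k).
case: (pickP A) => [k0 Ak0|A0]; last first.
  exists B => //; split; first by left.
  move=> k ck bk t t_gt0 _ E; have := A0 k; rewrite /A ck /= E.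
  by rewrite mulfK // t_gt0.
case: (arg_minP (fun k => a k / b k) Ak0) => k /andP[ck ak] kmin.
exists (a k / b k) => //; split.
  right; exists k => //; rewrite divfK //.
  by apply: contraTneq ak => ->; rewrite invr0 mulr0 ltxx.
move=> l cl bl t t_gt0 ts E; have Al : A l by rewrite /A cl E mulfK.
by have := kmin l Al; rewrite E mulfK // leNgt ts.
Qed.

End PiecewiseLinear.

Section Bracket.
Variables (R : realType) (K : finType) (c a b : K -> R).

(** [next_kink] is used for [b] and, by reflection, for [- b]; the condition [a k != 0] excludes a
    concave bend at 0 itself. *)
Lemma pwl_bracket (B : R) : 0 < B ->
  (forall k, c k < 0 -> b k != 0 /\ a k != 0) ->
  exists s1 s2, [/\ s1 < 0, 0 < s2,
    s1 = - B \/ (exists2 k, c k < 0 & a k = s1 * b k),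
    s2 = B \/ (exists2 k, c k < 0 & a k = s2 * b k) &
    (s2 - s1) * pwl c a b 0 <= s2 * pwl c a b s1 - s1 * pwl c a b s2].
Proof.
move=> B_gt0 bad.
have [s2 s2_gt0 [s2P s2F]] := next_kink c a b B_gt0.
have [s1 s1_gt0 [s1P s1F]] := next_kink c a (fun k => - b k) B_gt0.
exists (- s1), s2; split=> //; first by rewrite oppr_lt0.
- case: s1P => [->|[k ck E]]; first by left.
  by right; exists k => //; rewrite E mulNr mulrN.
- have := @pwl_convex R K c a b (- s1) 0 s2; rewrite subr0 sub0r mulNr; apply.
  + by rewrite oppr_le0 ltW.
  + exact: ltW.
  + move=> k ck; have [bk ak] := bad k ck; split=> // s ss1 ss2 E.
    case: (ltrgt0P s) => hs.
    * exact: s2F E.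
    * by apply: (s1F k ck _ (- s)); rewrite ?oppr_eq0 ?oppr_gt0 ?mulrNN //; lra.
    * by move: ak; rewrite E hs mul0r eqxx.
Qed.
End Bracket.

(** * The Airy function of a self-stress *)

Section Airy.
Variables (R : realType) (n : nat) (P : 'I_n -> pt R).
Implicit Types (d x : pt R) (w : 'I_n -> 'I_n -> R).

Definition cross (u v : pt R) : R := u.1 * v.2 - u.2 * v.1.

(** Diagonal entries multiply a zero vector and are unconstrained, so vanishing is later claimed
    only off the diagonal. *)
Definition self_stress w : Prop :=
  (forall i j, w i j = w j i) /\
  forall i, \sum_j w i j * ((P j).1 - (P i).1) = 0 /\
            \sum_j w i j * ((P j).2 - (P i).2) = 0.

Definition dets x (i j : 'I_n) : R := cross (ptsub (P i) x) (ptsub (P j) x).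

Lemma sqnorm_gt0 (u : pt R) : u != (0, 0) -> 0 < u.1 * u.1 + u.2 * u.2.
Proof.
case: u => a b; rewrite xpair_eqE negb_and /= -!expr2 => /orP[h|h].
  by rewrite ltr_pwDl ?sqr_ge0 // exprn_even_gt0.
by rewrite ltr_wpDl ?sqr_ge0 // exprn_even_gt0.
Qed.

Definition left_of d x (i : 'I_n) : bool := 0 < cross d (ptsub (P i) x).

(** Of the two orientations of an edge meeting both sides of the line, only the one from right to
    left is kept; [dets] is then positive exactly when the crossing is ahead of [x]. *)
Definition cut w d x (k : 'I_n * 'I_n) : R :=
  w k.1 k.2 * (~~ left_of d x k.1 && left_of d x k.2)%:R.

(* The moment about [x] of the stress crossing the ray from [x] in direction
   [d]; points on the line itself count as lying to its right. *)
Definition airy w d x : R := \sum_k cut w d x k * Num.max 0 (dets x k.1 k.2).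

Definition on_ray x d (s : R) : pt R := ptadd x (ptscale s d).

Lemma left_on_ray x d s i : left_of d (on_ray x d s) i = left_of d x i.
Proof.
rewrite /left_of /cross /on_ray /ptsub /ptadd /ptscale /=.
by congr (0 < _); ring.
Qed.

Lemma cut_on_ray w x d s : cut w d (on_ray x d s) = cut w d x.
Proof. by apply/funext => k; rewrite /cut !left_on_ray. Qed.

Lemma dets_on_ray x d s i j :
  dets (on_ray x d s) i j = dets x i j - s * cross d (ptsub (P j) (P i)).
Proof.
by rewrite /dets /cross /on_ray /ptsub /ptadd /ptscale /=; ring.
Qed.

(** Moving along [d] preserves the line, hence the cut; hinge [k] bends where the moving point meets
    the line of edge [k]. *)
Lemma airy_on_ray w x d s :
  airy w d (on_ray x d s) =
  pwl (cut w d x) (fun k => dets x k.1 k.2)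
    (fun k => cross d (ptsub (P k.2) (P k.1))) s.
Proof.
by rewrite /airy cut_on_ray; apply: eq_bigr => k _; rewrite dets_on_ray.
Qed.

Lemma on_ray0 x d : on_ray x d 0 = x.
Proof. by case: x => x y; rewrite /on_ray /ptadd /ptscale /= !mul0r !addr0. Qed.

Lemma cut_neq0 w d x k : cut w d x k != 0 ->
  [/\ ~~ left_of d x k.1, left_of d x k.2 &
      0 < cross d (ptsub (P k.2) (P k.1))].
Proof.
rewrite /cut; case: (boolP (left_of d x k.1)); first by rewrite mulr0 eqxx.
case: (boolP (left_of d x k.2)); last by rewrite mulr0 eqxx.
move=> h2 h1 _; split=> //; move: h1 h2.
by rewrite /left_of /cross /ptsub /=; lra.
Qed.

Lemma cut_lt0 w d x k : cut w d x k < 0 -> w k.1 k.2 < 0.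
Proof.
rewrite /cut; case: (_ && _); first by rewrite mulr1.
by rewrite mulr0 ltxx.
Qed.

Lemma dets_sym x i j : dets x j i = - dets x i j.
Proof. by rewrite /dets /cross; ring. Qed.

Section Stress.
Variables (w : 'I_n -> 'I_n -> R) (ws : self_stress w).

Lemma moment0 x i : \sum_j w i j * dets x i j = 0.
Proof.
have [h1 h2] := ws.2 i.
transitivity ((ptsub (P i) x).1 * (\sum_j w i j * ((P j).2 - (P i).2)) -
  (ptsub (P i) x).2 * (\sum_j w i j * ((P j).1 - (P i).1))); last first.
  by rewrite h1 h2 !mulr0 subr0.
rewrite !mulr_sumr -sumrB; apply: eq_bigr => j _.
by rewrite /dets /cross /ptsub /=; ring.
Qed.

(** Summing [moment0] over the vertices in [A] leaves this cut, since the pairs inside [A] cancel by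
    antisymmetry of [dets]. *)
Lemma cut_moment0 x (A : pred 'I_n) :
  \sum_(k : 'I_n * 'I_n) w k.1 k.2 * (A k.1 && ~~ A k.2)%:R * dets x k.1 k.2 = 0.
Proof.
rewrite -(pair_bigA _ (fun i j => w i j * (A i && ~~ A j)%:R * dets x i j)) /=.
pose S := \sum_i \sum_j w i j * (A i && A j)%:R * dets x i j.
have S0 : S = 0.
  have : S = - S; last by lra.
  rewrite {1}/S exchange_big /= -sumrN; apply: eq_bigr => i _.
  rewrite -sumrN; apply: eq_bigr => j _.
  by rewrite dets_sym ws.1 andbC mulrN.
rewrite -[LHS]addr0 -[X in _ + X]S0 /S -big_split big1 //= => i _.
rewrite -big_split /=; transitivity ((A i)%:R * \sum_j w i j * dets x i j).
  rewrite mulr_sumr.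
  by apply: eq_bigr => j _; case: (A i); case: (A j); rewrite /=; ring.
by rewrite moment0 mulr0.
Qed.

(** One edge under a change of direction: [a1], [a2] and [b1], [b2] are the heights of its ends over
    the old and the new line, and [D] is its moment about [x]. The change is [D] charged to the ends
    that are swept over. *)
Lemma dir_change (c D a1 a2 b1 b2 : R) : 0 < c ->
  c * D = a1 * b2 - a2 * b1 ->
  ((~~ (0 < a1) && (0 < a2))%:R * Num.max 0 D +
   (~~ (0 < a2) && (0 < a1))%:R * Num.max 0 (- D)) -
  ((~~ (0 < b1) && (0 < b2))%:R * Num.max 0 D +
   (~~ (0 < b2) && (0 < b1))%:R * Num.max 0 (- D)) =
  ((0 < a2) && ~~ (0 < b2))%:R * D - ((0 < a1) && ~~ (0 < b1))%:R * D.
Proof.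
move=> c0 E.
have [D0|D0|D0] := ltrgt0P D.
- have : 0 < a1 * b2 - a2 * b1 by rewrite -E mulr_gt0.
  rewrite max_l ?oppr_le0 ?ltW // => Ep.
  by case: (ltP 0 a1) => ?; case: (ltP 0 a2) => ?; case: (ltP 0 b1) => ?;
     case: (ltP 0 b2) => ? /=; rewrite ?mul1r ?mul0r ?mulr0
       ?subr0 ?addr0 ?sub0r ?oppr0 ?subrr //; nra.
- have : a1 * b2 - a2 * b1 < 0 by rewrite -E pmulr_rlt0.
  rewrite max_r ?oppr_ge0 ?ltW // => Ep.
  by case: (ltP 0 a1) => ?; case: (ltP 0 a2) => ?; case: (ltP 0 b1) => ?;
     case: (ltP 0 b2) => ? /=; rewrite ?mul1r ?mul0r ?mulr0
       ?subr0 ?addr0 ?sub0r ?add0r ?opprK ?oppr0 ?subrr //; nra.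
- by rewrite D0 oppr0 maxxx !mulr0 addr0 subr0.
Qed.

Lemma airyE (d x : pt R) :
  airy w d x = \sum_i \sum_j w i j *
    ((~~ left_of d x i && left_of d x j)%:R * Num.max 0 (dets x i j)).
Proof.
rewrite /airy -(pair_bigA _ (fun i j => cut w d x (i, j) * Num.max 0 (dets x i j))) /=.
by apply: eq_bigr => i _; apply: eq_bigr => j _; rewrite /cut /= mulrA.
Qed.

(** Turning the ray adds or removes the full moments of the vertices in the swept wedge, and these
    vanish by [moment0]. The sum is doubled so that both orientations of an edge are compared
    together. *)
Lemma airy_dir_pos d d' x : 0 < cross d d' -> airy w d x = airy w d' x.
Proof.
move=> dd; pose F d i j := w i j *
    ((~~ left_of d x i && left_of d x j)%:R * Num.max 0 (dets x i j)).
have dbl e : 2 * airy w e x = \sum_i \sum_j (F e i j + F e j i).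
  rewrite mulrDl mul1r {2}airyE exchange_big airyE -big_split /=.
  by apply: eq_bigr => i _; rewrite -big_split.
suff : 2 * airy w d x - 2 * airy w d' x = 0 by lra.
pose chi i : R := (left_of d x i && ~~ left_of d' x i)%:R.
transitivity (\sum_i \sum_j (w i j * dets x i j * chi j)
            - \sum_i \sum_j (w i j * dets x i j * chi i)).
  rewrite !dbl -!sumrB; apply: eq_bigr => i _.
  rewrite -!sumrB; apply: eq_bigr => j _.
  rewrite /F [w j i]ws.1 [dets x j i]dets_sym -!mulrDr -mulrBr.
  rewrite (@dir_change (cross d d')) //; first by rewrite /chi; ring.
  by rewrite /dets /cross; ring.
rewrite exchange_big /= !big1 ?subrr // => i _.
  by rewrite -mulr_suml moment0 mul0r.
rewrite -mulr_suml.
under eq_bigr => j _ do rewrite ws.1 dets_sym mulrN.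
by rewrite sumrN moment0 oppr0 mul0r.
Qed.

Lemma airy_dir d d' x : d != (0, 0) -> d' != (0, 0) -> airy w d x = airy w d' x.
Proof.
move=> /sqnorm_gt0 dn /sqnorm_gt0 dn'.
have [dd|dd|dd] := ltrgt0P (cross d d').
- exact: airy_dir_pos.
- by symmetry; apply: airy_dir_pos; move: dd; rewrite /cross; lra.
(* Parallel directions, possibly opposite, are compared through a perpendicular one. *)
pose e : pt R := (- d.2, d.1).
have de : 0 < cross d e by rewrite /cross /e /=; lra.
rewrite (airy_dir_pos _ de).
have nz : cross e d' != 0.
  apply/negP => /eqP ed; move: dd ed dn dn'; rewrite /cross /e /=.
  by nra.
have [h|h|h] := ltrgt0P (cross e d').
- exact: airy_dir_pos.
- by symmetry; apply: airy_dir_pos; move: h; rewrite /cross; lra.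
- by rewrite h eqxx in nz.
Qed.

(** [B] exceeds every breakpoint. Far ahead no hinge is active; far behind all are, and they add up
    to the moment of the whole cut, which is zero. *)
Lemma airy_far d x : exists2 B, 0 < B &
  airy w d (on_ray x d B) = 0 /\ airy w d (on_ray x d (- B)) = 0.
Proof.
pose b (k : 'I_n * 'I_n) := cross d (ptsub (P k.2) (P k.1)).
pose a (k : 'I_n * 'I_n) := dets x k.1 k.2.
pose B := 1 + \sum_k `|a k| / `|b k|.
have B0 : 0 < B by rewrite ltr_pwDl // sumr_ge0 // => k _; rewrite divr_ge0.
have aB k : 0 < b k -> `|a k| <= B * b k.
  move=> bk; rewrite -ler_pdivrMr // -{1}(gtr0_norm bk) /B (bigD1 k) //=.
  rewrite addrCA lerDl addr_ge0 // sumr_ge0 // => l _.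
  by rewrite divr_ge0.
exists B => //; split; rewrite airy_on_ray /pwl -/(a _).
  apply: big1 => k _; have [-> |] := eqVneq (cut w d x k) 0; first by rewrite mul0r.
  case/cut_neq0 => _ _ bk; rewrite max_l ?mulr0 //.
  by have := aB k bk; rewrite -/(a k) -/(b k) ler_norml; lra.
rewrite -[RHS](cut_moment0 (on_ray x d (- B)) (fun i => ~~ left_of d x i)).
apply: eq_bigr => k _; rewrite negbK -/(cut w d x k) dets_on_ray.
have [-> |] := eqVneq (cut w d x k) 0; first by rewrite !mul0r.
case/cut_neq0 => _ _ bk; rewrite max_r //.
by have := aB k bk; rewrite -/(a k) -/(b k) ler_norml; lra.
Qed.

End Stress.
End Airy.

(** * The maximum principle *)

Section MaxPrinciple.
Variables (R : realType) (n : nat) (P : 'I_n -> pt R).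
Hypotheses (n3 : (3 <= n)%N) (gp : general_position P).
Implicit Types (d x : pt R) (w : 'I_n -> 'I_n -> R).

Lemma det3_dets i j k : det3 (P i) (P j) (P k) = dets P (P i) j k.
Proof. by rewrite /det3 /dets /cross /ptsub /=; ring. Qed.

Lemma dets_neq0 i j k : i != j -> j != k -> i != k -> dets P (P i) j k != 0.
Proof. by move=> ij jk ik; rewrite -det3_dets gp. Qed.

Lemma exists_third (i j : 'I_n) : exists k : 'I_n, (k != i) && (k != j).
Proof.
have : (0 < #|~: [set i; j]|)%N.
  rewrite cardsCs setCK card_ord subn_gt0; apply: leq_trans n3.
  by rewrite ltnS cards2; case: (_ != _).
by case/card_gt0P => k; rewrite !inE negb_or; exists k.
Qed.

(** Two coinciding points would be collinear with any third one, and [3 <= n] provides a third. *)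
Lemma P_inj i j : i != j -> ptsub (P j) (P i) != (0, 0).
Proof.
move=> ij; have [k /andP[ki kj]] := exists_third i j.
have := dets_neq0 ij (_ : j != k) (_ : i != k).
rewrite eq_sym kj eq_sym ki => /(_ isT isT).
apply: contraNneq; rewrite /dets => ->.
by rewrite /cross /= !mul0r subrr.
Qed.

(** At a bend the point is collinear with the edge; the ends of a cut edge lie on the two sides of
    the line, so the point is between them. *)
Lemma kink_on_segment w d x s k : cut P w d x k != 0 ->
  dets P x k.1 k.2 = s * cross d (ptsub (P k.2) (P k.1)) ->
  on_segment (on_ray x d s) (P k.1) (P k.2).
Proof.
move=> /cut_neq0 [L1 L2 b0] /eqP; rewrite -subr_eq0 -dets_on_ray.
rewrite -(left_on_ray P x d s) in L1; rewrite -(left_on_ray P x d s) in L2.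
move: L1 L2 b0; rewrite /left_of /dets -leNgt; move: (on_ray x d s) => y.
case: y => y1 y2; case: (P k.1) => p1 p2; case: (P k.2) => q1 q2.
rewrite /on_segment /cross /ptsub /ptadd /ptscale /=.
set A1 := d.1 * (p2 - y2) - _; set A2 := d.1 * (q2 - y2) - _.
move=> A1le A2gt _ /eqP D0.
have A0 : 0 < A2 - A1 by lra.
(* The parameter at which the height over the line, [A1] at one end and [A2] at the other,
   interpolates to 0. *)
exists (- A1 / (A2 - A1)); split.
  apply/andP; split; first by rewrite divr_ge0 ?oppr_ge0 // ltW.
  by rewrite ler_pdivrMr //; lra.
have E1 : A2 * (p1 - y1) - A1 * (q1 - y1) = 0.
  transitivity (d.1 * ((p1 - y1) * (q2 - y2) - (p2 - y2) * (q1 - y1))).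
    by rewrite /A1 /A2; ring.
  by rewrite D0 mulr0.
have E2 : A2 * (p2 - y2) - A1 * (q2 - y2) = 0.
  transitivity (d.2 * ((p1 - y1) * (q2 - y2) - (p2 - y2) * (q1 - y1))).
    by rewrite /A1 /A2; ring.
  by rewrite D0 mulr0.
congr (_, _).
- apply: (mulfI (lt0r_neq0 A0)); transitivity (A2 * p1 - A1 * q1); first by lra.
  by field; apply: lt0r_neq0.
- apply: (mulfI (lt0r_neq0 A0)); transitivity (A2 * p2 - A1 * q2); first by lra.
  by field; apply: lt0r_neq0.
Qed.

(** Only signs enter, so that [w] and [- w] can be certified by two different graphs. *)
Definition neg_pointed_noncrossing w : Prop :=
  (forall i j k l x, i != j -> k != l -> w i j < 0 -> w k l < 0 ->
     on_segment x (P i) (P j) -> on_segment x (P k) (P l) ->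
     [\/ x = P i, x = P j, i = k /\ j = l | i = l /\ j = k]) /\
  forall i, exists u : pt R,
    forall j, i != j -> w i j < 0 -> 0 < dotp u (ptsub (P j) (P i)).

Lemma on_ray_inj x d s t : d != (0, 0) -> on_ray x d s = on_ray x d t -> s = t.
Proof.
case: d => d1 d2; rewrite xpair_eqE negb_and /= => d0 [] /addrI e1 /addrI e2.
by case/orP: d0 => h; [apply: (mulIf h e1) | apply: (mulIf h e2)].
Qed.

Lemma on_ray1 x y : on_ray x (ptsub y x) 1 = y.
Proof.
case: x => x1 x2; case: y => y1 y2.
by rewrite /on_ray /ptadd /ptscale /ptsub /= !mul1r ![_ + (_ - _)]addrC !subrK.
Qed.

Lemma on_segment_ray x y t :
  ptadd (ptscale (1 - t) x) (ptscale t y) = on_ray x (ptsub y x) t.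
Proof.
by rewrite /on_ray /ptadd /ptscale /ptsub /=; congr (_, _); ring.
Qed.

Section Bound.
Variables (w : 'I_n -> 'I_n -> R) (ws : self_stress P w).
Hypothesis wn : neg_pointed_noncrossing w.

Let H x := airy P w (1, 0) x.

Lemma airy_horizontal d x : d != (0, 0) -> H x = airy P w d x.
Proof.
by move=> d0; apply: airy_dir => //; rewrite xpair_eqE oner_eq0.
Qed.

Lemma cut_neq d x k : cut P w d x k != 0 -> k.1 != k.2.
Proof. by case/cut_neq0 => h1 h2 _; apply: contraNneq h1 => ->. Qed.

(** No other negative edge meets the interior of this one, and the edge itself, parallel to [d], is
    not in the cut; so there is no concave bend between the endpoints. *)
Lemma airy_edge j k t : j != k -> w j k < 0 -> 0 <= t -> t <= 1 ->
  H (on_ray (P j) (ptsub (P k) (P j)) t) <= (1 - t) * H (P j) + t * H (P k).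
Proof.
move=> jk wjk t0 t1; set d := ptsub (P k) (P j).
have d0 : d != (0, 0) by exact: P_inj.
have dE : on_ray (P j) d 1 = P k by exact: on_ray1.
rewrite -[in leRHS](on_ray0 (P j) d) -[in leRHS]dE !(airy_horizontal _ d0) !airy_on_ray.
have := @pwl_convex R _ (cut P w d (P j)) (fun k => dets P (P j) k.1 k.2)
  (fun k => cross d (ptsub (P k.2) (P k.1))) 0 t 1 t0 t1.
rewrite !subr0 mul1r; apply=> l cl.
have cl0 : cut P w d (P j) l != 0 by rewrite lt_eqF.
have [_ _ b0] := cut_neq0 cl0; split; first by rewrite gt_eqF.
move=> s s0 s1 E; have xl := kink_on_segment cl0 E.
have xj : on_segment (on_ray (P j) d s) (P j) (P k).
  by exists s; rewrite !ltW // on_segment_ray.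
case: (wn.1 _ _ _ _ _ jk (cut_neq cl0) wjk (cut_lt0 cl) xj xl).
- by rewrite -{2}(on_ray0 (P j) d) => /(on_ray_inj d0) s_0; rewrite s_0 ltxx in s0.
- by rewrite -dE => /(on_ray_inj d0) s_1; rewrite s_1 ltxx in s1.
- by case=> jl kl; move: b0; rewrite -jl -kl /d /cross mulrC subrr ltxx.
- by case=> jl kl; move: b0; rewrite -jl -kl /d /cross /ptsub /=; nra.
Qed.

Lemma airy_segment x j k : j != k -> w j k < 0 -> on_segment x (P j) (P k) ->
  H x <= H (P j) \/ H x <= H (P k).
Proof.
move=> jk wjk [t [/andP[t0 t1] ->]]; rewrite on_segment_ray.
have := airy_edge jk wjk t0 t1.
have [h|h] := lerP (H (P j)) (H (P k)) => hh; [right | left]; nra.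
Qed.

Definition on_neg_edge x : Prop :=
  exists j k, [/\ j != k, w j k < 0 & on_segment x (P j) (P k)].

(** Along a line the function is convex up to the nearest negative edge on either side, or else out
    to where it has vanished. *)
Lemma airy_bracket d x : d != (0, 0) ->
  (forall l, cut P w d x l < 0 -> dets P x l.1 l.2 != 0) ->
  exists s1 s2, [/\ s1 < 0, 0 < s2,
    H (on_ray x d s1) = 0 \/ on_neg_edge (on_ray x d s1),
    H (on_ray x d s2) = 0 \/ on_neg_edge (on_ray x d s2) &
    (s2 - s1) * H x <= s2 * H (on_ray x d s1) - s1 * H (on_ray x d s2)].
Proof.
move=> d0 dl; have [B B0 [far1 far2]] := airy_far ws d x.
have [|s1 [s2 [s10 s20 h1 h2 h3]]] := @pwl_bracket R _ (cut P w d x)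
  (fun k => dets P x k.1 k.2) (fun k => cross d (ptsub (P k.2) (P k.1))) B B0.
  move=> l cl; split; last exact: dl.
  have cl0 : cut P w d x l != 0 by rewrite lt_eqF.
  by have [_ _ b0] := cut_neq0 cl0; rewrite gt_eqF.
have edge s : (exists2 l, cut P w d x l < 0 &
    dets P x l.1 l.2 = s * cross d (ptsub (P l.2) (P l.1))) ->
    on_neg_edge (on_ray x d s).
  case=> l cl E; have cl0 : cut P w d x l != 0 by rewrite lt_eqF.
  exists l.1, l.2; split; [exact: cut_neq cl0|exact: cut_lt0 cl|].
  exact: kink_on_segment cl0 E.
exists s1, s2; split=> //.
- by case: h1 => [->|/edge]; [left; rewrite (airy_horizontal _ d0) | right].
- by case: h2 => [->|/edge]; [left; rewrite (airy_horizontal _ d0) | right].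
- by rewrite !(airy_horizontal _ d0) -{1}(on_ray0 x d) !airy_on_ray.
Qed.

(** Off the negative edges, convexity gives a bracket end with value at least [H x > 0]; that end
    must lie on a negative edge, where convexity again leads to an endpoint. *)
Lemma airy_le_vertex x : 0 < H x -> exists i, H x <= H (P i).
Proof.
move=> Hx; have seg y : on_neg_edge y -> exists i, H y <= H (P i).
  by case=> j [k [jk wjk yjk]]; case: (airy_segment jk wjk yjk) => h;
    [exists j | exists k].
have [/seg//|nx] := pselect (on_neg_edge x).
have d0 : (1, 0) != (0, 0) :> pt R by rewrite xpair_eqE oner_eq0.
have [|s1 [s2 [s10 s20 h1 h2 h3]]] := @airy_bracket (1, 0) x d0.
  move=> l cl; apply: contra_notN nx => /eqP E.
  have cl0 : cut P w (1, 0) x l != 0 by rewrite lt_eqF.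
  exists l.1, l.2; split; [exact: cut_neq cl0|exact: cut_lt0 cl|].
  by rewrite -(on_ray0 x (1, 0)); apply: kink_on_segment cl0 _; rewrite mul0r.
move: h1 h2 h3; set y1 := on_ray _ _ s1; set y2 := on_ray _ _ s2 => h1 h2 h3.
have [h|h] : H x <= H y1 \/ H x <= H y2.
  have [h|h] := lerP (H x) (H y1); first by left.
  by right; nra.
- by case: h1 => [E|/seg[i hi]]; [lra | exists i; lra].
- by case: h2 => [E|/seg[i hi]]; [lra | exists i; lra].
Qed.

(** The pointedness vector turned by a right angle: all negative edges at [i] are strictly right of
    the line, so none enters the cut at [P i]. *)
Lemma pointed_direction i : exists2 d : pt R, d != (0, 0) &
  forall j, i != j -> w i j < 0 -> cross d (ptsub (P j) (P i)) < 0.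
Proof.
have [u uP] := wn.2 i.
have [u0|u0] := eqVneq u (0, 0).
  exists (1, 0); first by rewrite xpair_eqE oner_eq0.
  by move=> j ij wij; have := uP j ij wij; rewrite u0 /dotp /= !mul0r addr0 ltxx.
exists (- u.2, u.1).
  by apply: contraNneq u0 => -[/eqP]; rewrite oppr_eq0 => /eqP a b; case: (u) a b => ? ? /= -> ->.
by move=> j ij wij; have := uP j ij wij; rewrite /cross /dotp /=; lra.
Qed.

(* Among the vertices where the maximum is attained, take the one farthest
   from the origin: moving along a line through it, the squared norm increases
   in one of the two directions, while pointedness keeps the Airy function
   constant up to the next negative edge. *)
Lemma airy_le0 x : H x <= 0.
Proof.
rewrite leNgt; apply/negP => Hx.
have [i0 hi0] := airy_le_vertex Hx.
case: (@arg_maxP _ _ _ i0 xpredT (fun i => H (P i)) isT) => i1 _ max1.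
set M := H (P i1) in max1.
have M0 : 0 < M by apply: lt_le_trans Hx (le_trans hi0 (max1 _ isT)).
have HM y : H y <= M.
  have [h|/airy_le_vertex[i hi]] := lerP (H y) 0; first exact: le_trans (ltW M0).
  exact: le_trans hi (max1 i isT).
pose N (y : pt R) := y.1 * y.1 + y.2 * y.2.
case: (@arg_maxP _ _ _ i1 (fun i => H (P i) == M) (fun i => N (P i)) (eqxx _)).
move=> i /eqP iM max2.
have [d d0 dP] := pointed_direction i.
have [|s1 [s2 [s10 s20 h1 h2 h3]]] := @airy_bracket d (P i) d0.
  move=> l cl; have cl0 : cut P w d (P i) l != 0 by rewrite lt_eqF.
  have [_ L2 _] := cut_neq0 cl0; have ll := cut_neq cl0.
  have [l1|l1] := eqVneq i l.1.
    have := dP l.2; rewrite {1 2}l1 => /(_ ll (cut_lt0 cl)).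
    by move: L2; rewrite /left_of; lra.
  have [l2|l2] := eqVneq i l.2; last exact: dets_neq0.
  by move: L2; rewrite -l2 /left_of /cross /ptsub !subrr !mulr0 subrr ltxx.
move: h3 (HM (on_ray (P i) d s1)) (HM (on_ray (P i) d s2)); rewrite iM => h3 m1 m2.
(* A point of value [M] on a negative edge forces each endpoint of nonzero weight to attain [M],
   hence to be no farther than [P i]; convexity of [N] then bounds the point as well. *)
have no s : H (on_ray (P i) d s) = 0 \/ on_neg_edge (on_ray (P i) d s) ->
    M <= H (on_ray (P i) d s) -> ~ N (P i) < N (on_ray (P i) d s).
  case=> [-> ?|]; first lra.
  case=> j [k [jk wjk [t [/andP[t0 t1] E]]]] Ms Ns.
  have := airy_edge jk wjk t0 t1; rewrite -on_segment_ray -E => He.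
  have Nj : (1 - t) * N (P j) <= (1 - t) * N (P i).
    have [t_1|t_1] := eqVneq t 1; first by rewrite t_1 subrr !mul0r.
    apply: ler_wpM2l; first lra.
    apply: max2; rewrite eq_le HM /=.
    have : t < 1 by rewrite lt_neqAle t_1.
    have := HM (P k); nra.
  have Nk : t * N (P k) <= t * N (P i).
    have [t_0|t_0] := eqVneq t 0; first by rewrite t_0 !mul0r.
    apply: ler_wpM2l; first lra.
    apply: max2; rewrite eq_le HM /=.
    have : 0 < t by rewrite lt_neqAle eq_sym t_0.
    have := HM (P j); nra.
  suff : N (on_ray (P i) d s) <= (1 - t) * N (P j) + t * N (P k) by lra.
  rewrite E -subr_ge0 /N /ptadd /ptscale /=.
  have -> : (1 - t) * ((P j).1 * (P j).1 + (P j).2 * (P j).2) +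
   t * ((P k).1 * (P k).1 + (P k).2 * (P k).2) -
   (((1 - t) * (P j).1 + t * (P k).1) * ((1 - t) * (P j).1 + t * (P k).1) +
    ((1 - t) * (P j).2 + t * (P k).2) * ((1 - t) * (P j).2 + t * (P k).2)) =
   t * (1 - t) * (((P j).1 - (P k).1) ^+ 2 + ((P j).2 - (P k).2) ^+ 2) by ring.
  by rewrite mulr_ge0 ?addr_ge0 ?sqr_ge0 // mulr_ge0 // subr_ge0.
have d2 := sqnorm_gt0 d0.
have Ninc s : s != 0 -> 0 <= s * ((P i).1 * d.1 + (P i).2 * d.2) ->
    N (P i) < N (on_ray (P i) d s).
  move=> s0 sd; rewrite -subr_gt0 /N /on_ray /ptadd /ptscale /=.
  have s2p : 0 < s ^+ 2 by rewrite exprn_even_gt0.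
  have -> : ((P i).1 + s * d.1) * ((P i).1 + s * d.1) +
   ((P i).2 + s * d.2) * ((P i).2 + s * d.2) -
   ((P i).1 * (P i).1 + (P i).2 * (P i).2) =
   2 * (s * ((P i).1 * d.1 + (P i).2 * d.2)) +
   s ^+ 2 * (d.1 * d.1 + d.2 * d.2) by ring.
  by have := mulr_gt0 s2p d2; lra.
(* Both bracket ends attain [M]; this sign tells which one is farther from the origin. *)
have [pd|pd] := lerP 0 ((P i).1 * d.1 + (P i).2 * d.2).
- apply: (no s2 h2); first by nra.
  by apply: Ninc; [rewrite gt_eqF | rewrite mulr_ge0 // ltW].
- apply: (no s1 h1); first by nra.
  by apply: Ninc; [rewrite lt_eqF | rewrite mulr_le0 // ltW].
Qed.

End Bound.

Lemma self_stressN w : self_stress P w -> self_stress P (fun i j => - w i j).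
Proof.
case=> ws we; split=> [i j|i]; first by rewrite ws.
have [e1 e2] := we i; split.
  by under eq_bigr do rewrite mulNr; rewrite sumrN e1 oppr0.
by under eq_bigr do rewrite mulNr; rewrite sumrN e2 oppr0.
Qed.

Lemma airyN w d x : airy P (fun i j => - w i j) d x = - airy P w d x.
Proof.
by rewrite /airy -sumrN; apply: eq_bigr => k _; rewrite /cut !mulNr.
Qed.

(** The maximum principle for [w] and [- w] makes the Airy function vanish. The weights are read off
    from its bends, first in the position at [P i], then in the direction of the line. *)
Lemma stress_eq0 w : self_stress P w -> neg_pointed_noncrossing w ->
  neg_pointed_noncrossing (fun i j => - w i j) ->
  forall i j, i != j -> w i j = 0.
Proof.
move=> ws wn wp.
have H0 d x : d != (0, 0) -> airy P w d x = 0.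
  move=> d0; have wsN := self_stressN ws.
  have := airy_le0 ws wn x; have := airy_le0 wsN wp x.
  by rewrite (airy_horizontal ws x d0) (airy_horizontal wsN x d0) airyN; lra.
move=> i j ij; set e := ptsub (P j) (P i).
(* By general position, only edges at [i] bend at [P i]. *)
have star0 d : d != (0, 0) ->
    \sum_k w i k * Num.max 0 (cross d (ptsub (P k) (P i))) = 0.
  move=> d0.
  have := @pwl_kink R _ (cut P w d (P i)) (fun k => dets P (P i) k.1 k.2)
    (fun k => cross d (ptsub (P k.2) (P k.1))).
  move=> /(_ (fun s => etrans (esym (airy_on_ray P w (P i) d s)) (H0 _ _ d0))) K0.
  transitivity (\sum_l \sum_(m | dets P (P i) l m == 0)
      cut P w d (P i) (l, m) * `|cross d (ptsub (P m) (P l))|); last first.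
    by rewrite pair_big_dep -[RHS]K0; apply: eq_big => -[].
  rewrite [RHS](bigD1 i) //= [X in _ + X]big1 ?addr0.
    rewrite [RHS]big_mkcond /=; apply: eq_bigr => k _.
    have -> : dets P (P i) i k = 0 by rewrite /dets /cross /ptsub !subrr !mul0r subrr.
    have Li : left_of P d (P i) i = false.
      by rewrite /left_of /cross /ptsub !subrr !mulr0 subrr ltxx.
    rewrite eqxx /cut /= Li /= /left_of.
    case: ltrP => h; last by rewrite !mulr0 mul0r.
    by rewrite mulr1 gtr0_norm.
  move=> l li; apply: big1 => m /eqP D0.
  have [-> |c0] := eqVneq (cut P w d (P i) (l, m)) 0; first by rewrite mul0r.
  have [_ L2 _] := cut_neq0 c0; have lm := cut_neq c0.
  have [im|im] := eqVneq i m.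
    by move: L2; rewrite /= -im /left_of /cross /ptsub !subrr !mulr0 subrr ltxx.
  by have := @dets_neq0 i l m; rewrite D0 eqxx eq_sym => /(_ li lm im).
have e0 : e != (0, 0) by exact: P_inj.
have e2 := sqnorm_gt0 e0.
(* As the direction [e + s g] turns through the edge [ij], only the term of [j] contributes a bend
   at [s = 0], of size [|e|^2]. *)
pose g : pt R := (- e.2, e.1).
have := @pwl_kink R _ (w i) (fun k => cross e (ptsub (P k) (P i)))
    (fun k => - cross g (ptsub (P k) (P i))).
have pwl0 s : pwl (w i) (fun k => cross e (ptsub (P k) (P i)))
    (fun k => - cross g (ptsub (P k) (P i))) s = 0.
  rewrite -(star0 (on_ray e g s)); last first.
    apply/negP => /eqP [h1 h2]; have : e.1 * (e.1 + s * - e.2) + e.2 * (e.2 + s * e.1) = 0.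
      by rewrite h1 h2 !mulr0 addr0.
    by lra.
  apply: eq_bigr => k _; congr (_ * Num.max 0 _).
  by rewrite /on_ray /cross /ptadd /ptscale /=; ring.
move=> /(_ pwl0); rewrite (bigD1 j) /=; last by rewrite /e /cross mulrC subrr.
rewrite big1 ?addr0.
  move=> /eqP; rewrite mulf_eq0 normrN normr_eq0 => /orP[/eqP//|/eqP].
  rewrite -/e => g0; exfalso; move: e2 g0; rewrite /cross /g /=; lra.
move=> k /andP[/eqP ek kj].
have [ik|ik] := eqVneq i k.
  by rewrite -ik /cross /ptsub !subrr !mulr0 subrr oppr0 normr0 mulr0.
have jk : j != k by rewrite eq_sym.
by have := dets_neq0 ij jk ik; rewrite /dets -/e ek eqxx.
Qed.

End MaxPrinciple.

(** * Nondegenerate polyhedra *)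

Section Polyhedron.
Variables (R : realType) (N : nat) (K : finType) (r : K -> 'cV[R]_N).
Implicit Types (x y v : 'rV[R]_N) (S : {set K}).

Definition pairing (c : 'cV[R]_N) x : R := (x *m c) 0 0.

Lemma pairingD c x y : pairing c (x + y) = pairing c x + pairing c y.
Proof. by rewrite /pairing mulmxDl mxE. Qed.

Lemma pairingZ c t x : pairing c (t *: x) = t * pairing c x.
Proof. by rewrite /pairing -scalemxAl mxE. Qed.

Lemma pairingN c x : pairing c (- x) = - pairing c x.
Proof. by rewrite /pairing mulNmx mxE. Qed.

Lemma pairing_suml (I : finType) (A : pred I) (l : I -> R) (c : I -> 'cV[R]_N) x :
  pairing (\sum_(i | A i) l i *: c i) x = \sum_(i | A i) l i * pairing (c i) x.
Proof.
rewrite /pairing mulmx_sumr summxE; apply: eq_bigr => i _.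
by rewrite -scalemxAr mxE.
Qed.

Definition indep S : Prop :=
  forall l : K -> R, \sum_(k in S) l k *: r k = 0 -> forall k, k \in S -> l k = 0.

Definition cols S : 'M[R]_(N, #|S|) := \matrix_(i, l) r (enum_val l) i 0.

Lemma mul_cols S x (l : 'I_#|S|) i : (x *m cols S) i l = pairing (r (enum_val l)) x.
Proof.
by rewrite /pairing !mxE (ord1 i); apply: eq_bigr => j _; rewrite !mxE.
Qed.

Lemma mul_cols0 S x : x *m cols S = 0 <-> forall k, k \in S -> pairing (r k) x = 0.
Proof.
split=> [x0 k kS|x0].
  by rewrite -(enum_rankK_in kS kS) -(mul_cols _ _ 0) x0 mxE.
by apply/matrixP => i l; rewrite mul_cols mxE x0 ?enum_valP.
Qed.

Lemma cols_comb S (u : 'rV[R]_#|S|) :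
  exists l : K -> R, (forall i, l (enum_val i) = u 0 i) /\
    \sum_(k in S) l k *: r k = cols S *m u^T.
Proof.
pose l k := \sum_(i : 'I_#|S| | enum_val i == k) u 0 i.
have lE i : l (enum_val i) = u 0 i.
  by rewrite /l (big_pred1 i) // => j; rewrite (inj_eq enum_val_inj).
exists l; split=> //; rewrite big_enum_val; apply/matrixP => a j.
rewrite summxE !mxE (ord1 j); apply: eq_bigr => i _.
by rewrite !mxE lE mulrC.
Qed.

Lemma rank_cols S : indep S -> \rank (cols S) = #|S|.
Proof.
move=> iS; rewrite -mxrank_tr; apply/eqP; apply/row_freeP.
apply/row_freeP/negPn/negP => nf.
have /rowV0Pn [u uk u0] : kermx (cols S)^T != 0 by rewrite kermx_eq0.
have [l [lE lS]] := cols_comb u.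
case/eqP: u0; apply/matrixP => i j; rewrite (ord1 i) mxE -lE.
apply: iS (enum_valP j); rewrite lS.
by apply: trmx_inj; rewrite trmx_mul trmxK trmx0; apply/sub_kermxP.
Qed.

Lemma indep_solve S (t : K -> R) : indep S ->
  exists x, forall k, k \in S -> pairing (r k) x = t k.
Proof.
move=> iS; pose u : 'rV[R]_#|S| := \row_i t (enum_val i).
have /submxP [x xE] : (u <= cols S)%MS.
  by apply: submx_full; rewrite /row_full rank_cols.
exists x => k kS; rewrite -(enum_rankK_in kS kS) -(mul_cols _ _ 0) -xE mxE.
by rewrite (enum_rankK_in kS kS).
Qed.

(** A vector outside the span is not killed by some column of the cokernel; up to sign, that column
    is the descent direction. *)
Lemma span_or_descent S (c : 'cV[R]_N) :
  (exists l : K -> R, c = \sum_(k in S) l k *: r k) \/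
  (exists2 v, forall k, k \in S -> pairing (r k) v = 0 & pairing c v < 0).
Proof.
have [/submxP [u uE]|] := boolP (c^T <= (cols S)^T)%MS.
  left; have [l [_ lS]] := cols_comb u; exists l.
  by rewrite lS; apply: trmx_inj; rewrite uE trmx_mul trmxK.
rewrite submxE => nz; right.
have /existsP [j cj] : [exists j, (c^T *m cokermx (cols S)^T) 0 j != 0].
  apply: contraR nz; rewrite negb_exists => /forallP z.
  by apply/eqP/matrixP => i j; rewrite (ord1 i) [RHS]mxE; apply/eqP; have := z j; rewrite negbK.
pose v := (col j (cokermx (cols S)^T))^T.
have v0 k : k \in S -> pairing (r k) v = 0.
  move: k; apply/mul_cols0; apply: trmx_inj.
  by rewrite trmx_mul trmx0 /v trmxK colE mulmxA mulmx_coker mul0mx.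
have vc : pairing c v != 0.
  rewrite /pairing.
  suff -> : v *m c = (col j (c^T *m cokermx (cols S)^T))^T by rewrite mxE [X in X != 0]mxE.
  by rewrite colE -mulmxA -colE trmx_mul trmxK.
have [h|h] := ltP (pairing c v) 0; first by exists v.
have cv : 0 < pairing c v by rewrite lt_neqAle eq_sym vc.
exists (- v); last by rewrite pairingN oppr_lt0.
by move=> k kS; rewrite pairingN v0 ?oppr0.
Qed.

Definition affine_free k (x : 'I_k -> 'rV[R]_N) : Prop :=
  forall c : 'I_k -> R, \sum_l c l = 0 -> \sum_l c l *: x l = 0 ->
  forall l, c l = 0.

Variables (b : K -> R) (Eq D : {set K}).

Definition polyhedron x : Prop :=
  (forall k, k \in Eq -> pairing (r k) x = b k) /\
  (forall k, k \in D -> b k <= pairing (r k) x).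

Definition tightset x : {set K} := Eq :|: [set k in D | pairing (r k) x == b k].

Lemma tightP x k : polyhedron x -> k \in tightset x -> pairing (r k) x = b k.
Proof. by case=> h _; rewrite !inE => /orP[/h//|/andP[_ /eqP]]. Qed.

(** A short step preserves the slack of the loose constraints, so only the tight ones restrict the
    direction, and those that [v] increases are released. *)
Lemma small_step x v : polyhedron x -> (forall k, k \in Eq -> pairing (r k) v = 0) ->
  (forall k, k \in tightset x -> 0 <= pairing (r k) v) ->
  exists2 e, 0 < e & polyhedron (x + e *: v) /\
    forall k, k \in tightset (x + e *: v) -> k \in tightset x /\ pairing (r k) v = 0.
Proof.
move=> [xE xD] vE vT.
have [e e0 eP] := small_scale (fun k => pairing (r k) x - b k) (fun k => pairing (r k) v).
have st k : k \in D -> k \notin tightset x -> b k < pairing (r k) (x + e *: v).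
  move=> kD; rewrite !inE negb_or kD /= -subr_eq0 => /andP[_ nt].
  have := eP k nt; rewrite pairingD pairingZ -{1}(gtr0_norm e0) -normrM.
  by rewrite [X in _ < X]ger0_norm ?subr_ge0 ?xD // ltr_norml; lra.
exists e => //; split; first split=> k kh.
- by rewrite pairingD pairingZ vE // mulr0 addr0 xE.
- have [kT|/(st k kh)/ltW//] := boolP (k \in tightset x).
  by rewrite pairingD pairingZ ler_wpDr ?xD // mulr_ge0 ?vT // ltW.
- move=> k; rewrite [in X in X -> _]inE => /orP[kE|]; first by rewrite vE // !inE kE.
  rewrite inE => /andP[kD /eqP E].
  have [kT|/(st k kD)] := boolP (k \in tightset x); last by rewrite E ltxx.
  split=> //; move: E; rewrite pairingD pairingZ (@tightP x) //.
  move/eqP; rewrite -subr_eq0 addrAC subrr add0r mulf_eq0 gt_eqF //=.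
  by move/eqP.
Qed.

(** The ratio test of the simplex method: the first inequality reached along [v] joins the tight
    set. *)
Lemma ratio_step x v : polyhedron x -> (forall k, k \in tightset x -> pairing (r k) v = 0) ->
  (exists2 k, k \in D & pairing (r k) v < 0) ->
  exists2 t, 0 < t & polyhedron (x + t *: v) /\ tightset x \proper tightset (x + t *: v).
Proof.
move=> [xE xD] vT [k0 k0D k0v].
pose A k := (k \in D) && (pairing (r k) v < 0).
pose q k := (pairing (r k) x - b k) / - pairing (r k) v.
have Ak0 : A k0 by rewrite /A k0D.
case: (arg_minP q Ak0) => k /andP[kD kv] kmin.
have knt : k \notin tightset x by apply: contraTN kv => /vT ->; rewrite ltxx.
have q0 : 0 < q k.
  rewrite divr_gt0 ?oppr_gt0 // subr_gt0 lt_neqAle xD // andbT eq_sym.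
  by apply: contra knt; rewrite !inE kD orbC => ->.
have qk : pairing (r k) (x + q k *: v) = b k.
  by rewrite pairingD pairingZ /q invrN mulrN mulNr divfK ?lt_eqF // opprB addrC subrK.
exists (q k) => //; split; first split=> l lh.
- by rewrite pairingD pairingZ vT ?mulr0 ?addr0 ?xE // inE lh.
- rewrite pairingD pairingZ; have [lv|lv] := lerP 0 (pairing (r l) v).
    by rewrite ler_wpDr ?xD // mulr_ge0 // ltW.
  have := kmin l; rewrite /A lh lv => /(_ isT); rewrite {2}/q.
  by rewrite ler_pdivlMr ?oppr_gt0 //; lra.
- rewrite properE; apply/andP; split.
    apply/subsetP => l lT; move: (lT); rewrite !inE => /orP[->//|/andP[lD lb]].
    by rewrite lD pairingD pairingZ vT // mulr0 addr0 lb orbT.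
  by apply/subsetPn; exists k => //; rewrite !inE kD qk eqxx orbT.
Qed.

(* Nondegenerate simplex method: a stationary point of smallest value exists
   because the value there is determined by the tight set. *)
Lemma lp_optimum (c : 'cV[R]_N) x0 m : polyhedron x0 ->
  (forall x, polyhedron x -> indep (tightset x)) ->
  (forall x, polyhedron x -> m <= pairing c x) ->
  exists x (l : K -> R), [/\ polyhedron x, c = \sum_(k in tightset x) l k *: r k &
    forall k, k \in tightset x -> k \notin Eq -> 0 <= l k].
Proof.
move=> px0 nondeg cbd.
pose stat x := exists l : K -> R, c = \sum_(k in tightset x) l k *: r k.
have reach x : polyhedron x -> exists2 y, polyhedron y /\ stat y & pairing c y <= pairing c x.
  have [p] := ubnP (#|~: tightset x|); elim: p x => // p IH x.
  rewrite ltnS => xp px; have [sx|[v v0 cv]] := span_or_descent (tightset x) c.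
    by exists x.
  have [k kD kv] : exists2 k, k \in D & pairing (r k) v < 0.
    apply/exists_inP; apply: contraT; rewrite negb_exists_in => /forall_inP nv.
    (* If nothing blocked [v], this step would bring the objective down to [m - 1]. *)
    pose t := (pairing c x - m + 1) / - pairing c v.
    have t0 : 0 < t.
      by rewrite divr_gt0 ?oppr_gt0 // ltr_wpDl // subr_ge0 cbd.
    have /cbd : polyhedron (x + t *: v).
      split=> k kh; rewrite pairingD pairingZ.
        by rewrite v0 ?inE ?kh // mulr0 addr0 px.1.
      by rewrite ler_wpDr ?px.2 // mulr_ge0 ?(ltW t0) // leNgt nv.
    rewrite pairingD pairingZ /t invrN mulrN mulNr divfK ?lt_eqF //; lra.
  have [t t0 [py prop]] := ratio_step px v0 (ex_intro2 _ _ k kD kv).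
  have [|//|y py' yle] := IH (x + t *: v).
    by apply: leq_trans xp; rewrite proper_card // properC.
  exists y => //; apply: le_trans yle _.
  by rewrite pairingD pairingZ gerDl pmulr_rle0 // ltW.
pose real S := exists x, [/\ polyhedron x, stat x & tightset x = S].
(* One representative per tight set of a stationary point, so that a minimum is taken over finitely
   many sets; [x0] is a dummy value. *)
have /choice [g gP] : forall S, exists x, real S -> [/\ polyhedron x, stat x & tightset x = S].
  by move=> S; have [[x xP]|nr] := pselect (real S); [exists x | exists x0].
have valE x y : polyhedron x -> polyhedron y -> stat x ->
    tightset x = tightset y -> pairing c x = pairing c y.
  move=> px py [l ->] E; rewrite !pairing_suml; apply: eq_bigr => k kx.
  by rewrite (tightP px kx) (tightP py) // -E.
have [x1 [px1 sx1] _] := reach x0 px0.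
have r1 : `[< real (tightset x1) >] by apply/asboolP; exists x1.
case: (@arg_minP _ _ _ (tightset x1) (fun S => `[< real S >])
  (fun S => pairing c (g S)) r1) => S /asboolP /gP [px sx xS] Smin.
set x := g S in px sx xS Smin.
have xmin y : polyhedron y -> pairing c x <= pairing c y.
  move=> /reach [z [pz sz] zy]; apply: le_trans zy.
  have rz : real (tightset z) by exists z.
  have [pgz sgz gz] := gP _ rz.
  by rewrite -(valE _ _ pgz pz sgz gz); apply: Smin; apply/asboolP.
have [l cl] := sx; exists x, l; split=> // k kT kE; rewrite leNgt; apply/negP => lk.
(* This direction leaves constraint [k] alone; a negative multiplier would make it a descent
   direction. *)
have [v vP] := indep_solve (fun k' => (k' == k)%:R) (nondeg x px).
have [||e e0 [pe _]] := @small_step x v px.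
- move=> k' k'E; rewrite vP ?inE ?k'E //; case: eqP => // kk.
  by rewrite -kk k'E in kE.
- by move=> k' k'T; rewrite vP // ler0n.
have := xmin _ pe; rewrite pairingD pairingZ lerDl leNgt pmulr_rlt0 // => /negP; apply.
rewrite cl pairing_suml (bigD1 k) //= big1 ?addr0 => [|k' /andP[k'T k'k]].
  by rewrite vP // eqxx mulr1.
by rewrite vP // (negPf k'k) mulr0.
Qed.

Lemma tightset_sub x : tightset x \subset Eq :|: D.
Proof. by apply/subsetP => k; rewrite !inE => /orP[->//|/andP[-> _]]; rewrite orbT. Qed.

Lemma mem_tightset x k : k \in Eq :|: D -> pairing (r k) x = b k -> k \in tightset x.
Proof. by rewrite !inE => /orP[->//|-> ->]; rewrite eqxx orbT. Qed.

(** Independence provides a direction with value 1 on the constraints to release and 0 on [A]. *)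
Lemma drop_tight x (A : {set K}) : polyhedron x -> indep (tightset x) ->
  Eq \subset A -> A \subset tightset x -> exists2 y, polyhedron y & tightset y = A.
Proof.
move=> px ix EA AT.
have [v vP] := indep_solve (fun k => (k \notin A)%:R) ix.
have v0 k : k \in A -> pairing (r k) v = 0.
  by move=> kA; rewrite vP ?(subsetP AT) // kA.
have [||e e0 [py yT]] := @small_step x v px.
- by move=> k /(subsetP EA) /v0.
- by move=> k kT; rewrite vP // ler0n.
exists (x + e *: v) => //; apply/eqP; rewrite eqEsubset; apply/andP; split.
  apply/subsetP => k /yT [kT]; rewrite vP //.
  by case: (k \in A) => //= /eqP; rewrite oner_eq0.
apply/subsetP => k kA; have kT := subsetP AT k kA.
apply: mem_tightset; first exact: (subsetP (tightset_sub x)).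
by rewrite pairingD pairingZ v0 // mulr0 addr0 (tightP px).
Qed.

(** The supporting functional is the sum of the rows in [A]: a total of nonnegative slacks is zero
    only if each is. *)
Lemma tight_face (A : {set K}) y : Eq \subset A -> A \subset Eq :|: D -> polyhedron y ->
  let c := \sum_(k in A) 1 *: r k in
  \sum_(k in A) b k <= pairing c y /\
  (pairing c y = \sum_(k in A) b k <-> A \subset tightset y).
Proof.
move=> EA AD py c.
have cE : pairing c y = \sum_(k in A) pairing (r k) y.
  by rewrite pairing_suml; apply: eq_bigr => k _; rewrite mul1r.
have le k : k \in A -> b k <= pairing (r k) y.
  by move/(subsetP AD); rewrite inE => /orP[/py.1->//|/py.2].
rewrite cE; split; first exact: ler_sum.
split=> [/eqP|AT]; last by apply: eq_bigr => k kA; rewrite (tightP py) // (subsetP AT).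
rewrite -subr_eq0 -sumrB psumr_eq0 => [/allP h|k kA]; last by rewrite subr_ge0 le.
apply/subsetP => k kA; apply: mem_tightset; first exact: (subsetP AD).
by have := h k (mem_index_enum _); rewrite kA subr_eq0 => /eqP.
Qed.

Section Face.
Variables (c : 'cV[R]_N) (m : R).
Hypothesis cm : forall x, polyhedron x -> m <= pairing c x.

Lemma face_interior x : polyhedron x -> pairing c x = m ->
  exists x0, [/\ polyhedron x0, pairing c x0 = m &
    forall y, polyhedron y -> pairing c y = m -> tightset x0 \subset tightset y].
Proof.
have [p] := ubnP (#|tightset x|); elim: p x => // p IH x.
rewrite ltnS => xp px cx.
have [[y [py cy /subsetPn [k kx ky]]]|h] := pselect (exists y,
    [/\ polyhedron y, pairing c y = m & ~~ (tightset x \subset tightset y)]); last first.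
  exists x; split=> // y py cy; apply: contra_notT h => h.
  by exists y.
pose z := 2^-1 *: (x + y).
have zE d : pairing d z = 2^-1 * (pairing d x + pairing d y) by rewrite pairingZ pairingD.
have pz : polyhedron z.
  split=> l lh; rewrite zE; first by rewrite px.1 ?py.1 //; lra.
  by have := px.2 l lh; have := py.2 l lh; lra.
have zT l : l \in tightset z -> l \in tightset x /\ l \in tightset y.
  rewrite !inE; case: (l \in Eq) => //= /andP[lD /eqP]; rewrite zE => E.
  have := px.2 l lD; have := py.2 l lD => hx hy.
  by rewrite lD /=; split; apply/eqP; lra.
apply: (IH z) => //; last by rewrite zE cx cy; lra.
apply: leq_trans xp; apply: proper_card; rewrite properE; apply/andP; split.
  by apply/subsetP => l /zT [].
by apply/subsetPn; exists k => //; apply: contra ky => /zT [].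
Qed.

(** [x0] can be pushed slightly away from [y] inside the polyhedron; the bound [cm] there yields
    [pairing c y <= m]. *)
Lemma face_tight x0 y : polyhedron x0 -> pairing c x0 = m -> polyhedron y ->
  tightset x0 \subset tightset y -> pairing c y = m.
Proof.
move=> p0 c0 py T0.
have v0 k : k \in tightset x0 -> pairing (r k) (x0 - y) = 0.
  move=> kT; rewrite pairingD pairingN (tightP p0) // (tightP py) ?subrr //.
  exact: (subsetP T0).
have [||e e0 [pe _]] := @small_step x0 (x0 - y) p0.
- by move=> k kE; rewrite v0 // inE kE.
- by move=> k /v0 ->.
apply/eqP; rewrite eq_le cm // andbT -subr_ge0 -(pmulr_rge0 _ e0).
by have := cm pe; rewrite pairingD pairingZ pairingD pairingN c0 lerDl.
Qed.

End Face.

(** The points are [x0] and one short step from it along each basis vector of the kernel of the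
    tight rows. *)
Lemma face_dim_ge x0 : polyhedron x0 -> indep (tightset x0) ->
  exists y : 'I_(N - #|tightset x0|).+1 -> 'rV[R]_N,
    (forall l, polyhedron (y l) /\ tightset x0 \subset tightset (y l)) /\ affine_free y.
Proof.
move=> p0 i0; set S := tightset x0.
rewrite -(rank_cols i0) -mxrank_ker -/S.
set W := row_base (kermx (cols S)).
have Wf : row_free W by exact: row_base_free.
have W0 i k : k \in S -> pairing (r k) (row i W) = 0.
  move: k; apply/mul_cols0; apply/sub_kermxP.
  by apply: submx_trans (row_sub i W) _; rewrite eq_row_base.
have st i : exists e, 0 < e /\ polyhedron (x0 + e *: row i W).
  have [||e e0 [pe _]] := @small_step x0 (row i W) p0.
  - by move=> k kE; rewrite W0 // inE kE.
  - by move=> k /(W0 i) ->.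
  by exists e.
have /choice [e eP] := st.
pose y l := if unlift ord0 l is Some i then x0 + e i *: row i W else x0.
have y0 : y ord0 = x0 by rewrite /y unlift_none.
have yS i : y (lift ord0 i) = x0 + e i *: row i W by rewrite /y liftK.
exists y; split.
  move=> l; case: (unliftP ord0 l) => [i ->|->]; last by rewrite y0.
  rewrite yS; split; first exact: (eP i).2.
  apply/subsetP => k kS; apply: mem_tightset; first exact: (subsetP (tightset_sub x0)).
  by rewrite pairingD pairingZ W0 // mulr0 addr0 (tightP p0).
move=> c; rewrite !big_ord_recl y0 => c0 cy.
have cS i : c (lift ord0 i) = 0.
  pose u := \row_i (c (lift ord0 i) * e i).
  have yE : \sum_j c (lift ord0 j) *: y (lift ord0 j) =
      (\sum_j c (lift ord0 j)) *: x0 + \sum_j u 0 j *: row j W.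
    rewrite scaler_suml -big_split; apply: eq_bigr => j _.
    by rewrite mxE yS scalerDr scalerA.
  move: cy; rewrite yE addrA -scalerDl c0 scale0r add0r -mulmx_sum_row.
  rewrite -(mul0mx _ W) => /(row_free_inj Wf)/matrixP/(_ 0 i)/eqP.
  by rewrite !mxE mulf_eq0 (gt_eqF (eP i).1) orbF => /eqP.
move=> l; case: (unliftP ord0 l) => [i ->//|->].
by rewrite big1 ?addr0 in c0.
Qed.

Lemma face_dim_le S (x : 'I_(N - #|S|).+2 -> 'rV[R]_N) : indep S ->
  (forall l k, k \in S -> pairing (r k) (x l) = b k) -> ~ affine_free x.
Proof.
move=> iS xS fr.
pose M := \matrix_(i < (N - #|S|).+1) (x (lift ord0 i) - x ord0).
have MS : (M <= kermx (cols S))%MS.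
  apply/row_subP => i; rewrite rowK; apply/sub_kermxP/mul_cols0 => k kS.
  by rewrite pairingD pairingN !xS ?subrr.
have nf : ~~ row_free M.
  rewrite /row_free; apply/negP => /eqP E.
  by have := mxrankS MS; rewrite mxrank_ker rank_cols // E ltnn.
have /rowV0Pn [u /sub_kermxP uM /eqP u0] : kermx M != 0 by rewrite kermx_eq0.
apply: u0; apply/matrixP => a i; rewrite (ord1 a) mxE.
pose c l := if unlift ord0 l is Some i then u 0 i else - \sum_i u 0 i.
have c0 : c ord0 = - \sum_i u 0 i by rewrite /c unlift_none.
have cS j : c (lift ord0 j) = u 0 j by rewrite /c liftK.
rewrite -cS; apply: fr; rewrite big_ord_recl.
  by rewrite (eq_bigr _ (fun j _ => cS j)) c0 addNr.
rewrite -[RHS]uM mulmx_sum_row c0 scaleNr scaler_suml -sumrN -big_split.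
by apply: eq_bigr => j _; rewrite cS rowK scalerBr addrC.
Qed.

End Polyhedron.

(** * Tight edges of a feasible motion *)

Lemma on_segment_sym (R : realType) (x p q : pt R) : on_segment x p q -> on_segment x q p.
Proof.
case=> t [/andP[t0 t1] ->]; exists (1 - t); split; first by apply/andP; split; lra.
by rewrite /ptadd /ptscale /=; congr (_, _); ring.
Qed.

Lemma separator (R : realType) (K : finType) (lo up : pred K) (q : K -> R) :
  (forall k l, lo k -> up l -> q k < q l) ->
  exists t, (forall k, lo k -> q k < t) /\ (forall l, up l -> t < q l).
Proof.
move=> lu; have [k0 k0P|nolo] := pickP lo; last first.
  have [l0 l0P|noup] := pickP up; last first.
    by exists 0; split=> k; rewrite ?nolo ?noup.
  case: (arg_minP q l0P) => l _ lmin; exists (q l - 1); split=> [k|k /lmin h].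
    by rewrite nolo.
  lra.
case: (arg_maxP q k0P) => k kP kmax.
have [l0 l0P|noup] := pickP up; last first.
  exists (q k + 1); split=> [l /kmax h|l]; last by rewrite noup.
  by move: h; rewrite /=; lra.
case: (arg_minP q l0P) => l lP lmin; have klt := lu k l kP lP.
exists ((q k + q l) / 2); split=> [k' /kmax|l' /lmin] /= h; lra.
Qed.

Lemma neg_pointed_noncrossing_of_graph (R : realType) (n : nat) (P : 'I_n -> pt R)
    (G : {set 'I_n * 'I_n}) (w : 'I_n -> 'I_n -> R) :
  pointed_noncrossing P G ->
  (forall i j, i != j -> w i j < 0 -> adjacent G i j) ->
  neg_pointed_noncrossing P w.
Proof.
move=> [_ [nc pG]] wG; split; last first.
  by move=> i; have [u uP] := pG i; exists u => j ij /(wG _ _ ij)/uP.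
have edge i j k l x : (i, j) \in G -> (k, l) \in G ->
    on_segment x (P i) (P j) -> on_segment x (P k) (P l) ->
    [\/ x = P i, x = P j | i = k /\ j = l].
  move=> ijG klG xij xkl; have [[-> ->]|ne] := eqVneq (i, j) (k, l).
    by apply: Or33.
  by case: (nc _ _ ijG klG ne x xij xkl) => -[->|->] _; [apply: Or31|apply: Or32].
move=> i j k l x ij kl wij wkl xij xkl.
have xji := on_segment_sym xij; have xlk := on_segment_sym xkl.
case: (wG _ _ ij wij) (wG _ _ kl wkl) => [e1|e1] [e2|e2].
- by case: (edge _ _ _ _ _ e1 e2 xij xkl) => h; [apply: Or41|apply: Or42|apply: Or43].
- by case: (edge _ _ _ _ _ e1 e2 xij xlk) => h; [apply: Or41|apply: Or42|apply: Or44].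
- by case: (edge _ _ _ _ _ e1 e2 xji xkl) => h;
    [apply: Or42|apply: Or41|apply: Or44; case: h].
- by case: (edge _ _ _ _ _ e1 e2 xji xlk) => h;
    [apply: Or42|apply: Or41|apply: Or43; case: h].
Qed.

Section TightGraph.
Variables (R : realType) (a b : pt R) (n : nat) (P : 'I_n -> pt R).
Hypotheses (n3 : (3 <= n)%N) (gp : general_position P).
Let f := fun i j : 'I_n => det3 a (P i) (P j) * det3 b (P i) (P j).

(** With [y = p - x] and [z = q - x], [det(a,p,q)] equals [cross y z + cross (a - x) (y - z)]. In
    the product of two such factors everything except the square is the expansion of one field
    [g]. *)
Lemma det3_translate (x : pt R) : exists g : pt R -> pt R, forall p q,
  det3 a p q * det3 b p q =
  det3 x p q ^+ 2 + dotp (ptsub p q) (ptsub (g p) (g q)).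
Proof.
pose a1 := a.1 - x.1; pose a2 := a.2 - x.2.
pose b1 := b.1 - x.1; pose b2 := b.2 - x.2.
(* The quadratic part is [(y2, - y1)] times the cross product of [(a1 + b1, a2 + b2)] with [y], and
   gives the mixed terms. The linear part has as quadratic form the product of the cross products
   with [(a1, a2)] and [(b1, b2)]. *)
exists (fun p => let y1 := p.1 - x.1 in let y2 := p.2 - x.2 in
  ((a1 + b1) * y2 ^+ 2 - (a2 + b2) * (y1 * y2) + a2 * b2 * y1
     - (a1 * b2 + a2 * b1) * y2,
   - (a1 + b1) * (y1 * y2) + (a2 + b2) * y1 ^+ 2 + a1 * b1 * y2)).
by move=> p q; rewrite /det3 /dotp /ptsub /a1 /a2 /b1 /b2 /=; ring.
Qed.

Lemma det3_neq0 i j k : i != j -> j != k -> i != k -> det3 (P i) (P j) (P k) != 0.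
Proof. exact: gp. Qed.

Lemma vertex_off_segment i j k :
  i != j -> j != k -> i != k -> ~ on_segment (P k) (P i) (P j).
Proof.
move=> ij jk ik [t [_ E]]; have := gp ij jk ik; rewrite E.
by rewrite /det3 /ptadd /ptscale /= => /eqP; apply; ring.
Qed.

Definition inner_point (x p q : pt R) : Prop :=
  exists2 t, 0 < t < 1 & x = ptadd (ptscale (1 - t) p) (ptscale t q).

Lemma inner_point_sym x p q : inner_point x p q -> inner_point x q p.
Proof.
case=> t /andP[t0 t1] ->; exists (1 - t); first by apply/andP; split; lra.
by rewrite /ptadd /ptscale /=; congr (_, _); ring.
Qed.

Lemma on_segmentP x p q : on_segment x p q -> (x = p \/ x = q) \/ inner_point x p q.
Proof.
case=> t [/andP[t0 t1] ->].
have [->|tn0] := eqVneq t 0.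
  by left; left; case: p => ? ?; rewrite /ptadd /ptscale /= subr0 !mul1r !mul0r !addr0.
have [->|tn1] := eqVneq t 1.
  by left; right; case: q => ? ?; rewrite /ptadd /ptscale /= subrr !mul1r !mul0r !add0r.
by right; exists t => //; rewrite !lt_neqAle eq_sym tn0 tn1 t0 t1.
Qed.

Lemma inner_point_shared x i j l : i != j -> j != l -> i != l ->
  inner_point x (P i) (P j) -> ~ inner_point x (P i) (P l).
Proof.
move=> ij jl il [t /andP[t0 _] xj] [s _ xl].
have : t * det3 (P i) (P j) (P l) == 0.
  have -> : t * det3 (P i) (P j) (P l) = det3 (P i) x (P l).
    by rewrite xj /det3 /ptadd /ptscale /=; ring.
  by rewrite xl /det3 /ptadd /ptscale /=; apply/eqP; ring.
by rewrite mulf_eq0 gt_eqF //= (negPf (det3_neq0 ij jl il)).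
Qed.

Lemma vertex_on_segment i k l : k != l -> on_segment (P i) (P k) (P l) ->
  i = k \/ i = l.
Proof.
move=> kl h; have [->|ik] := eqVneq i k; first by left.
have [->|il] := eqVneq i l; first by right.
by case: (@vertex_off_segment k l i) => //; rewrite eq_sym.
Qed.

Section Motion.
Variable v : 'I_n -> pt R.
Hypothesis Xv : Xbar P f v.

Lemma f_sym i j : f i j = f j i.
Proof. by rewrite /f /det3; ring. Qed.

Lemma tight_sym i j : tight P f i j v -> tight P f j i v.
Proof. by rewrite /tight f_sym => <-; rewrite /dotp /ptsub /=; ring. Qed.

Lemma Xbar_ge i j : i != j ->
  f i j <= dotp (ptsub (P i) (P j)) (ptsub (v i) (v j)).
Proof.
rewrite neq_ltn => /orP[/(Xv.2 _ _)//|/(Xv.2 _ _)]; rewrite f_sym => h.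
by apply: le_trans h _; rewrite le_eqVlt; apply/orP; left; apply/eqP;
  rewrite /dotp /ptsub /=; ring.
Qed.

(** Subtracting the field [g] recentres the bounds at an [x] that can be chosen for each argument;
    [u] need not be normalised. *)
Lemma slack_recentred (x : pt R) : exists u : 'I_n -> pt R,
  (forall i j, i != j ->
     det3 x (P i) (P j) ^+ 2 <= dotp (ptsub (P i) (P j)) (ptsub (u i) (u j))) /\
  (forall i j, tight P f i j v ->
     dotp (ptsub (P i) (P j)) (ptsub (u i) (u j)) = det3 x (P i) (P j) ^+ 2).
Proof.
have [g gE] := det3_translate x.
exists (fun i => ptsub (v i) (g (P i))).
have uE i j : dotp (ptsub (P i) (P j)) (ptsub (ptsub (v i) (g (P i))) (ptsub (v j) (g (P j)))) =
    dotp (ptsub (P i) (P j)) (ptsub (v i) (v j)) -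
    dotp (ptsub (P i) (P j)) (ptsub (g (P i)) (g (P j))).
  by rewrite /dotp /ptsub /=; ring.
split=> i j.
  by move=> /Xbar_ge; rewrite /f gE uE; lra.
by rewrite /tight uE => ->; rewrite /f gE; lra.
Qed.

(** Recentred at the crossing, both tight edges have expansion 0. The dependency
    [(1-t, t, -(1-s), -s)] then forces a positive combination of the four sides' expansions to
    vanish, although that of [ik] is positive. *)
Lemma tight_no_crossing i j k l t s :
  i != j -> k != i -> k != j -> l != i -> l != j ->
  0 < t < 1 -> 0 < s < 1 -> tight P f i j v -> tight P f k l v ->
  ptadd (ptscale (1 - t) (P i)) (ptscale t (P j)) <>
  ptadd (ptscale (1 - s) (P k)) (ptscale s (P l)).
Proof.
move=> ij ki kj li lj /andP[t0 t1] /andP[s0 s1] Tij Tkl.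
set x := ptadd _ _ => xE.
have [u [ug ut]] := slack_recentred x.
have h1 : (1 - t) * (P i).1 + t * (P j).1 - (1 - s) * (P k).1 - s * (P l).1 = 0.
  by case: xE => -> _; ring.
have h2 : (1 - t) * (P i).2 + t * (P j).2 - (1 - s) * (P k).2 - s * (P l).2 = 0.
  by case: xE => _ ->; ring.
have eij : dotp (ptsub (P i) (P j)) (ptsub (u i) (u j)) = 0.
  by rewrite ut // /x /det3 /ptadd /ptscale /=; ring.
have ekl : dotp (ptsub (P k) (P l)) (ptsub (u k) (u l)) = 0.
  by rewrite ut // xE /det3 /ptadd /ptscale /=; ring.
have eik : 0 < dotp (ptsub (P i) (P k)) (ptsub (u i) (u k)).
  apply: lt_le_trans (ug i k _); last by rewrite eq_sym.
  have -> : det3 x (P i) (P k) = t * det3 (P j) (P i) (P k).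
    by rewrite /x /det3 /ptadd /ptscale /=; ring.
  rewrite exprn_even_gt0 //=; apply: mulf_neq0; first by rewrite gt_eqF.
  by apply: det3_neq0; rewrite eq_sym.
have nn p q : p != q -> 0 <= dotp (ptsub (P p) (P q)) (ptsub (u p) (u q)).
  by move=> pq; apply: le_trans (sqr_ge0 _) (ug _ _ pq).
have eil := nn i l; have ejk := nn j k; have ejl := nn j l.
rewrite eq_sym in li; rewrite eq_sym in kj; rewrite eq_sym in lj.
have : (1 - t) * (1 - s) * dotp (ptsub (P i) (P k)) (ptsub (u i) (u k)) +
  (1 - t) * s * dotp (ptsub (P i) (P l)) (ptsub (u i) (u l)) +
  t * (1 - s) * dotp (ptsub (P j) (P k)) (ptsub (u j) (u k)) +
  t * s * dotp (ptsub (P j) (P l)) (ptsub (u j) (u l)) = 0.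
  (* For weights [l] of sum 0, the expansions weighted by [l_p l_q] add up over all pairs to minus
     the inner product of [sum l P] and [sum l u]. *)
  transitivity ((1 - t) * t * dotp (ptsub (P i) (P j)) (ptsub (u i) (u j)) +
    (1 - s) * s * dotp (ptsub (P k) (P l)) (ptsub (u k) (u l)) +
    (((1 - t) * (P i).1 + t * (P j).1 - (1 - s) * (P k).1 - s * (P l).1) *
     ((1 - t) * (u i).1 + t * (u j).1 - (1 - s) * (u k).1 - s * (u l).1) +
     ((1 - t) * (P i).2 + t * (P j).2 - (1 - s) * (P k).2 - s * (P l).2) *
     ((1 - t) * (u i).2 + t * (u j).2 - (1 - s) * (u k).2 - s * (u l).2))).
    by rewrite /dotp /ptsub /=; ring.
  by rewrite eij ekl h1 h2; ring.
have t1' : 0 < 1 - t by lra.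
have s1' : 0 < 1 - s by lra.
have := mulr_gt0 (mulr_gt0 t1' s1') eik.
have := mulr_ge0 (ltW (mulr_gt0 t1' s0)) (eil li).
have := mulr_ge0 (ltW (mulr_gt0 t0 s1')) (ejk kj).
have := mulr_ge0 (ltW (mulr_gt0 t0 s0)) (ejl lj).
lra.
Qed.

(** Recentred at [P i], the spokes have expansion 0. The dependency has weights [mj], [mk], [ml] and
    minus their sum at [i], so the outer pairs balance to 0, against the positive expansion of
    [kl]. *)
Lemma tight_no_star i j k l (mj mk ml : R) :
  i != j -> i != k -> i != l -> k != l ->
  tight P f i j v -> tight P f i k v -> tight P f i l v ->
  0 <= mj -> 0 < mk -> 0 < ml ->
  ~ (mj * ((P j).1 - (P i).1) + mk * ((P k).1 - (P i).1) + ml * ((P l).1 - (P i).1) = 0 /\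
     mj * ((P j).2 - (P i).2) + mk * ((P k).2 - (P i).2) + ml * ((P l).2 - (P i).2) = 0).
Proof.
move=> ij ik il kl Tij Tik Til mj0 mk0 ml0 [h1 h2].
have [u [ug ut]] := slack_recentred (P i).
have e0 q : tight P f i q v -> dotp (ptsub (P i) (P q)) (ptsub (u i) (u q)) = 0.
  by move=> /ut ->; rewrite /det3; ring.
have nn p q : 0 <= dotp (ptsub (P p) (P q)) (ptsub (u p) (u q)).
  have [->|pq] := eqVneq p q; first by rewrite /dotp /ptsub !subrr !mul0r addr0.
  exact: le_trans (sqr_ge0 _) (ug _ _ pq).
have ekl : 0 < dotp (ptsub (P k) (P l)) (ptsub (u k) (u l)).
  by apply: lt_le_trans (ug k l kl); rewrite exprn_even_gt0 //= det3_neq0.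
have : mj * mk * dotp (ptsub (P j) (P k)) (ptsub (u j) (u k)) +
  mj * ml * dotp (ptsub (P j) (P l)) (ptsub (u j) (u l)) +
  mk * ml * dotp (ptsub (P k) (P l)) (ptsub (u k) (u l)) = 0.
  transitivity ((mj + mk + ml) *
     (mj * dotp (ptsub (P i) (P j)) (ptsub (u i) (u j)) +
      mk * dotp (ptsub (P i) (P k)) (ptsub (u i) (u k)) +
      ml * dotp (ptsub (P i) (P l)) (ptsub (u i) (u l))) -
    ((mj * ((P j).1 - (P i).1) + mk * ((P k).1 - (P i).1) + ml * ((P l).1 - (P i).1)) *
     (mj * ((u j).1 - (u i).1) + mk * ((u k).1 - (u i).1) + ml * ((u l).1 - (u i).1)) +
     (mj * ((P j).2 - (P i).2) + mk * ((P k).2 - (P i).2) + ml * ((P l).2 - (P i).2)) *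
     (mj * ((u j).2 - (u i).2) + mk * ((u k).2 - (u i).2) + ml * ((u l).2 - (u i).2)))).
    by rewrite /dotp /ptsub /=; ring.
  by rewrite !e0 // h1 h2; ring.
have := mulr_gt0 (mulr_gt0 mk0 ml0) ekl.
have := mulr_ge0 (mulr_ge0 mj0 (ltW mk0)) (nn j k).
have := mulr_ge0 (mulr_ge0 mj0 (ltW ml0)) (nn j l).
lra.
Qed.

(** The vector sought is the edge [ij] plus [t] times its normal. Neighbours on one side bound [t]
    below by [- al / be], those on the other side bound it above; incompatible bounds would produce
    an excluded star. *)
Lemma tight_pointed_at i : exists u : pt R,
  forall j, i != j -> tight P f i j v -> 0 < dotp u (ptsub (P j) (P i)).
Proof.
have [[j [ij Tij]]|none] := pselect (exists j, i != j /\ tight P f i j v); last first.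
  by exists (0, 0) => j ij Tij; case: none; exists j.
(* [al] and [be] are the coordinates, up to a positive factor, in the frame
   formed by the edge [ij] and its normal. *)
pose al k := dotp (ptsub (P j) (P i)) (ptsub (P k) (P i)).
pose be k := cross (ptsub (P j) (P i)) (ptsub (P k) (P i)).
pose N := dotp (ptsub (P j) (P i)) (ptsub (P j) (P i)).
have N0 : 0 < N by exact: sqnorm_gt0 (P_inj n3 gp ij).
pose nb k := [&& i != k, `[< tight P f i k v >] & k != j].
have sep : forall k l, nb k && (0 < be k) -> nb l && (be l < 0) ->
    - (al k / be k) < - (al l / be l).
  move=> k l /andP[/and3P[ik /asboolP Tik kj] bk] /andP[/and3P[il /asboolP Til lj] bl].
  rewrite ltNge; apply/negP => h.
  have kl : k != l by apply: contraTneq bk => ->; rewrite -leNgt ltW.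
  have h' : 0 <= - (be k * al l - be l * al k).
    have -> : - (be k * al l - be l * al k) = (- be l * be k) * (- (al k / be k) + al l / be l).
      by field; rewrite (gt_eqF bk) (lt_eqF bl).
    apply: mulr_ge0; last by lra.
    by apply: mulr_ge0; rewrite ?oppr_ge0 ltW.
  (* [N] times [P k - P i] is [al k] times the edge plus [be k] times its normal. The weights of [k]
     and [l] cancel the normal parts, that of [j] cancels the rest. *)
  apply: (@tight_no_star i j k l (- (be k * al l - be l * al k)) (- be l * N) (be k * N)) => //.
  - by rewrite mulr_gt0 // oppr_gt0.
  - by rewrite mulr_gt0.
  - by split; rewrite /al /be /N /dotp /cross /ptsub /=; ring.
have [t [tlo tup]] := separator sep.
pose e := ptsub (P j) (P i).
exists (e.1 - t * e.2, e.2 + t * e.1) => k ik Tik.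
have -> : dotp (e.1 - t * e.2, e.2 + t * e.1) (ptsub (P k) (P i)) = al k + t * be k.
  by rewrite /al /be /dotp /cross /=; ring.
have [-> |kj] := eqVneq k j.
  by rewrite -/N /be /cross [X in X - _]mulrC subrr mulr0 addr0.
have nk : nb k by rewrite /nb ik kj andbT; apply/asboolP.
have b0 : be k != 0 by apply: (dets_neq0 gp) => //; rewrite eq_sym.
have [bk|bk|bk] := ltrgt0P (be k).
- have := tlo k; rewrite nk bk => /(_ isT) h.
  have : 0 < be k * (t + al k / be k) by rewrite mulr_gt0 //; lra.
  by rewrite mulrDr [_ * (_ / _)]mulrC divfK //; lra.
- have := tup k; rewrite nk bk => /(_ isT) h.
  have : 0 < be k * (t + al k / be k) by rewrite nmulr_rgt0 //; lra.
  by rewrite mulrDr [_ * (_ / _)]mulrC divfK //; lra.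
- by rewrite bk eqxx in b0.
Qed.

(** Only a point interior to both segments needs excluding: general position does so when they share
    an endpoint, [tight_no_crossing] otherwise. *)
Lemma tight_noncrossing i j k l x : i != j -> k != l ->
  ~ (i = k /\ j = l \/ i = l /\ j = k) ->
  tight P f i j v -> tight P f k l v ->
  on_segment x (P i) (P j) -> on_segment x (P k) (P l) ->
  (x = P i \/ x = P j) /\ (x = P k \/ x = P l).
Proof.
move=> ij kl ne Tij Tkl xij xkl.
have vx p q r : q != r -> x = P p -> on_segment x (P q) (P r) -> x = P q \/ x = P r.
  by move=> qr -> /(vertex_on_segment qr)[->|->]; [left | right].
case: (on_segmentP xij) => [xv|iij].
  by split=> //; case: xv => xv; apply: vx xv xkl.
case: (on_segmentP xkl) => [xv|ikl].
  by split=> //; case: xv => xv; apply: vx xv xij.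
have iji := inner_point_sym iij; have ilk := inner_point_sym ikl.
have ji : j != i by rewrite eq_sym.
exfalso; have [ik|ki] := eqVneq i k.
  subst k; have [jl|jl] := eqVneq j l; first by apply: ne; left.
  exact: inner_point_shared ij jl kl iij ikl.
have [il|li] := eqVneq i l.
  subst l; have [jk|jk] := eqVneq j k; first by apply: ne; right.
  exact: inner_point_shared ij jk ki iij ilk.
have [jk|kj] := eqVneq j k.
  by subst k; apply: inner_point_shared ji li kl iji ikl.
have [jl|lj] := eqVneq j l.
  by subst l; apply: inner_point_shared ji ki kj iji ilk.
case: iij ikl => [t t01 ->] [s s01].
by apply: tight_no_crossing => //; rewrite eq_sym.
Qed.

Lemma tight_graph_pointed_noncrossing (G : {set 'I_n * 'I_n}) :
  (forall e, e \in G -> (e.1 < e.2)%N /\ tight P f e.1 e.2 v) ->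
  pointed_noncrossing P G.
Proof.
move=> GT.
have lt_neq (i j : 'I_n) : (i < j)%N -> i != j by rewrite neq_ltn => ->.
split; first by move=> e /GT[].
split.
  move=> e e' /GT[e12 Te] /GT[e12' Te'] ee' x xe xe'.
  apply: tight_noncrossing => //; [exact: lt_neq|exact: lt_neq|].
  case=> -[h1 h2]; last by move: e12 e12'; rewrite h1 h2; case: ltngtP.
  by case/eqP: ee'; case: (e) (e') h1 h2 => ? ? [? ?] /= -> ->.
move=> i; have [u uP] := tight_pointed_at i; exists u => j.
case=> /GT /= [ij T]; apply: uP => //; first exact: lt_neq.
  by rewrite eq_sym lt_neq.
exact: tight_sym.
Qed.

End Motion.
End TightGraph.

(** * The polyhedron of expansive motions *)

Section AffineDimension.
Variables (R : realType) (n : nat).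

Lemma aff_indep_comp k m (x : 'I_k -> motion R n) (g : 'I_m -> 'I_k) :
  injective g -> aff_indep x -> aff_indep (fun l => x (g l)).
Proof.
move=> gi xi c c0 cx l.
pose c' j := \sum_(i | g i == j) c i.
have c'E i : c' (g i) = c i.
  by rewrite /c' (big_pred1 i) // => j; rewrite (inj_eq gi).
have sumE (y : 'I_k -> R) : \sum_j c' j * y j = \sum_i c i * y (g i).
  rewrite [RHS](partition_big g xpredT) //=; apply: eq_bigr => j _.
  by rewrite mulr_suml; apply: eq_bigr => i /eqP ->.
rewrite -c'E; apply: xi => [|i].
  transitivity (\sum_j c' j * 1); first by apply: eq_bigr => j _; rewrite mulr1.
  by rewrite sumE -[RHS]c0; apply: eq_bigr => j _; rewrite mulr1.
by rewrite !sumE; apply: cx.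
Qed.

Lemma affdim_uniq (S : motion R n -> Prop) d1 d2 :
  affdim S d1 -> affdim S d2 -> d1 = d2.
Proof.
have lt d d' : affdim S d -> affdim S d' -> ~ (d < d')%N.
  move=> [_ nd] [[x [xS xi]] _] dd'; apply: nd.
  have le : (d.+2 <= d'.+1)%N by [].
  exists (fun l => x (widen_ord le l)); split=> [l|]; first exact: xS.
  apply: aff_indep_comp xi => i j /(congr1 val) /= ij.
  exact: val_inj.
move=> h1 h2; case: (ltngtP d1 d2) => // h.
  by case: (lt _ _ h1 h2 h).
by case: (lt _ _ h2 h1 h).
Qed.

End AffineDimension.

(** * Motions as row vectors of length [n + n] *)

Section Encoding.
Variables (R : realType) (n : nat).
Implicit Types (v c : motion R n).

Definition enc v : 'rV[R]_(n + n) := row_mx (\row_i (v i).1) (\row_i (v i).2).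

Definition dec (x : 'rV[R]_(n + n)) : motion R n :=
  fun i => (x 0 (lshift n i), x 0 (rshift n i)).

Lemma encK : cancel enc dec.
Proof.
move=> v; apply/funext => i; rewrite /dec /enc row_mxEl row_mxEr !mxE.
by case: (v i).
Qed.

Lemma decK : cancel dec enc.
Proof.
move=> x; apply/matrixP => a i; rewrite (ord1 a) /enc.
by case: (fintype.splitP i) => j ij;
  [have -> : i = lshift n j by exact: val_inj | have -> : i = rshift n j by exact: val_inj];
  rewrite ?row_mxEl ?row_mxEr !mxE.
Qed.

Lemma pairing_enc c x : pairing (enc c)^T x = lin c (dec x).
Proof.
rewrite /pairing mxE big_split_ord /= /lin -big_split /=; apply: eq_bigr => i _.
by rewrite ![_^T _ _]mxE /enc row_mxEl row_mxEr !mxE /dotp /dec /= mulrC [X in _ + X]mulrC.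
Qed.

Lemma aff_indep_dec k (x : 'I_k -> 'rV[R]_(n + n)) :
  aff_indep (fun l => dec (x l)) <-> affine_free x.
Proof.
split=> h c c0 cx; apply: h => //.
  by move=> i; split; have /matrixP /(_ 0) H := cx;
    [have := H (lshift n i) | have := H (rshift n i)];
    rewrite summxE [RHS]mxE => E; rewrite -[RHS]E; apply: eq_bigr => l _; rewrite mxE.
apply/matrixP => a i; rewrite (ord1 a) summxE [RHS]mxE.
case: (fintype.splitP i) => j ij; have [h1 h2] := cx j.
  have -> : i = lshift n j by exact: val_inj.
  by rewrite -[RHS]h1; apply: eq_bigr => l _; rewrite mxE.
have -> : i = rshift n j by exact: val_inj.
by rewrite -[RHS]h2; apply: eq_bigr => l _; rewrite mxE.
Qed.

End Encoding.

(** * The constraint rows and their dependencies *)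

Section Expansion.
Variables (R : realType) (a b : pt R) (n : nat) (P : 'I_n -> pt R).
Hypotheses (n3 : (3 <= n)%N) (gp : general_position P).
Hypothesis (y01 : forall i j : 'I_n, val i = 0%N -> val j = 1%N ->
  (P i).2 != (P j).2).
Let f := fun i j : 'I_n => det3 a (P i) (P j) * det3 b (P i) (P j).

Definition i0 : 'I_n := Ordinal (leq_trans (isT : 1 <= 3)%N n3).
Definition i1 : 'I_n := Ordinal (leq_trans (isT : 2 <= 3)%N n3).

(* [inl] indexes the three normalisation equations, [inr] the pairs of points. *)
Definition constraint : Type := (option bool + 'I_n * 'I_n)%type.

(** The [inr] rows are those of the rigidity matrix; the [inl] rows pin the rigid motions. *)
Definition row_motion (k : constraint) : motion R n := fun l =>
  match k with
  | inl None => ((l == i0)%:R, 0)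
  | inl (Some false) => (0, (l == i0)%:R)
  | inl (Some true) => ((l == i1)%:R, 0)
  | inr (i, j) => ptscale ((l == i)%:R - (l == j)%:R) (ptsub (P i) (P j))
  end.

Definition crow (k : constraint) : 'cV[R]_(n + n) := (enc (row_motion k))^T.

Lemma sum_delta (F : 'I_n -> R) i : \sum_l (l == i)%:R * F l = F i.
Proof.
rewrite (bigD1 i) //= eqxx mul1r big1 ?addr0 // => l /negPf ->.
by rewrite mul0r.
Qed.

Lemma lin_row k v : lin (row_motion k) v =
  match k with
  | inl None => (v i0).1
  | inl (Some false) => (v i0).2
  | inl (Some true) => (v i1).1
  | inr (i, j) => dotp (ptsub (P i) (P j)) (ptsub (v i) (v j))
  end.
Proof.
rewrite /lin; case: k => [[[]|]|[i j]] /=; rewrite /dotp /=.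
- by rewrite -[RHS](sum_delta (fun l => (v l).1)); apply: eq_bigr => l _; rewrite mul0r addr0.
- by rewrite -[RHS](sum_delta (fun l => (v l).2)); apply: eq_bigr => l _; rewrite mul0r add0r.
- by rewrite -[RHS](sum_delta (fun l => (v l).1)); apply: eq_bigr => l _; rewrite mul0r addr0.
pose F l := (ptsub (P i) (P j)).1 * (v l).1 + (ptsub (P i) (P j)).2 * (v l).2.
transitivity (F i - F j); last by rewrite /F /ptsub /=; ring.
rewrite -[F i]sum_delta -[F j]sum_delta -sumrB; apply: eq_bigr => l _.
by rewrite /F /ptscale /=; ring.
Qed.

Lemma pairing_crow k x : pairing (crow k) x = lin (row_motion k) (dec x).
Proof. exact: pairing_enc. Qed.

(* A linear relation between rows is tested on translations, on the rotation
   about the first point, and on the motions of a single point. *)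
Lemma relation_stress (p : option bool -> R) (m : 'I_n -> 'I_n -> R) :
  (forall v : motion R n, \sum_t p t * lin (row_motion (inl t)) v +
     \sum_i \sum_j m i j * dotp (ptsub (P i) (P j)) (ptsub (v i) (v j)) = 0) ->
  (forall t, p t = 0) /\ self_stress P (fun i j => m i j + m j i).
Proof.
move=> rel.
have i10 : (i1 == i0) = false by [].
have sumopt (F : option bool -> R) : \sum_t F t = F None + F (Some true) + F (Some false).
  rewrite (bigD1 None) //= (bigD1 (Some true)) //= (bigD1 (Some false)) //=.
  by rewrite big1 ?addr0 ?addrA // => -[[]|].
have rigid v : (forall i j, dotp (ptsub (P i) (P j)) (ptsub (v i) (v j)) = 0) ->
    p None * (v i0).1 + p (Some true) * (v i1).1 + p (Some false) * (v i0).2 = 0.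
  move=> v0; have := rel v; rewrite sumopt !lin_row [X in _ + X]big1 ?addr0 //.
  by move=> i _; apply: big1 => j _; rewrite v0 mulr0.
have e1 : p None + p (Some true) = 0.
  have := rigid (fun=> (1, 0)); rewrite /= !mulr1 mulr0 addr0; apply=> i j.
  by rewrite /dotp /ptsub /= !subrr !mulr0 addr0.
have e2 : p (Some false) = 0.
  have := rigid (fun=> (0, 1)); rewrite /= !mulr1 !mulr0 !add0r; apply=> i j.
  by rewrite /dotp /ptsub /= !subrr !mulr0 addr0.
(* The rotation moves [i1] horizontally by the difference of the two heights, nonzero by [y01]. *)
have e3 : p (Some true) = 0.
  pose v k : pt R := (- ((P k).2 - (P i0).2), (P k).1 - (P i0).1).
  have E : p None * (v i0).1 + p (Some true) * (v i1).1 + p (Some false) * (v i0).2 = 0.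
    by apply: rigid => i j; rewrite /dotp /ptsub /v /=; ring.
  have : p (Some true) * ((P i1).2 - (P i0).2) = 0 by move: E; rewrite /v /=; lra.
  by move/eqP; rewrite mulf_eq0 subr_eq0 [X in _ || X]eq_sym (negPf (y01 _ _)) // orbF => /eqP.
have p0 t : p t = 0 by case: t => [[]|] //; lra.
split=> //; split=> [i j|i]; first by rewrite addrC.
have test (d : pt R) : \sum_j (m i j + m j i) * dotp (ptsub (P j) (P i)) d = 0.
  have := rel (fun l => ptscale (l == i)%:R d).
  rewrite [X in X + _]big1 ?add0r => [E|t _]; last by rewrite p0 mul0r.
  have E2 : \sum_k \sum_j (k == i)%:R * (m k j * dotp (ptsub (P k) (P j)) d) -
      \sum_k \sum_j (j == i)%:R * (m k j * dotp (ptsub (P k) (P j)) d) = 0.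
    rewrite -[RHS]E -sumrB; apply: eq_bigr => k _; rewrite -sumrB.
    by apply: eq_bigr => j _; rewrite /dotp /ptsub /ptscale /=; ring.
  move: E2; under eq_bigr do rewrite -mulr_sumr.
  rewrite sum_delta; under [X in _ - X]eq_bigr do rewrite sum_delta.
  rewrite -sumrB => E2; rewrite -[RHS]oppr0 -[X in _ = - X]E2 -sumrN.
  by apply: eq_bigr => j _; rewrite /dotp /ptsub /=; ring.
split.
  rewrite -[RHS](test (1, 0)); apply: eq_bigr => j _.
  by rewrite /dotp /ptsub /=; ring.
rewrite -[RHS](test (0, 1)); apply: eq_bigr => j _.
by rewrite /dotp /ptsub /=; ring.
Qed.

Definition Eqs : {set constraint} := [set k : constraint | if k is inl _ then true else false].

Definition Ineqs : {set constraint} :=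
  [set k : constraint | if k is inr e then (e.1 < e.2)%N else false].

Definition rhs (k : constraint) : R := if k is inr e then f e.1 e.2 else 0.

Notation Xpoly := (polyhedron crow rhs Eqs Ineqs).
Notation tset := (tightset crow rhs Eqs Ineqs).

Definition tight_graph (v : motion R n) : {set 'I_n * 'I_n} :=
  [set e : 'I_n * 'I_n | (e.1 < e.2)%N &&
     (dotp (ptsub (P e.1) (P e.2)) (ptsub (v e.1) (v e.2)) == f e.1 e.2)].

(** Normalisation equations are always tight, so every tight set has this shape. *)
Definition full (G : {set 'I_n * 'I_n}) : {set constraint} :=
  [set k : constraint | match k with inl _ => true | inr e => e \in G end].

Lemma poly_Xbar x : Xpoly x <-> Xbar P f (dec x).
Proof.
split=> [[hE hD]|[hn hf]]; split.
- have h k : pairing (crow (inl k)) x = 0 by apply: hE; rewrite inE.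
  move=> i; split=> vi.
    have -> : i = i0 by exact: val_inj.
    by have := h None; have := h (Some false); rewrite !pairing_crow !lin_row.
  have -> : i = i1 by exact: val_inj.
  by have := h (Some true); rewrite !pairing_crow !lin_row.
- move=> i j ij; have := hD (inr (i, j)); rewrite inE ij => /(_ isT).
  by rewrite pairing_crow lin_row.
- move=> [[[]|]|e]; rewrite inE // => _; rewrite pairing_crow lin_row.
  + exact: (hn i1).2.
  + by have [h _] := hn i0; exact: (h erefl).2.
  + by have [h _] := hn i0; exact: (h erefl).1.
- move=> [t|[i j]]; rewrite inE //= => ij; rewrite pairing_crow lin_row.
  exact: hf.
Qed.

Lemma tightset_full x : tset x = full (tight_graph (dec x)).
Proof. by apply/setP => -[t|[i j]]; rewrite !inE // pairing_crow lin_row. Qed.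

Lemma fullS G G' : (full G \subset full G') = (G \subset G').
Proof.
apply/subsetP/subsetP => h => [e eG|[t|e]]; rewrite ?inE //; last exact: h.
by have := h (inr e); rewrite !inE; apply.
Qed.

Lemma card_full G : #|full G| = (3 + #|G|)%N.
Proof.
rewrite -!sum1_card big_mkcond big_sumType /= [in RHS]big_mkcond /=; congr (_ + _)%N.
  under eq_bigr do rewrite inE.
  by rewrite sum1_card card_option card_bool.
by apply: eq_bigr => e _; rewrite inE.
Qed.

Lemma comb_relation (l : constraint -> R) : \sum_k l k *: crow k = 0 ->
  (forall t, l (inl t) = 0) /\
  self_stress P (fun i j => l (inr (i, j)) + l (inr (j, i))).
Proof.
move=> l0; apply: relation_stress => v.
have : pairing (\sum_k l k *: crow k) (enc v) = 0 by rewrite l0 /pairing mulmx0 mxE.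
rewrite (pairing_suml xpredT) big_sumType /= => E; rewrite -[RHS]E; congr (_ + _).
  by apply: eq_bigr => t _; rewrite pairing_crow encK.
rewrite pair_bigA /=; apply: eq_bigr => -[i j] _.
by rewrite pairing_crow encK lin_row.
Qed.

(** A dependency is a self-stress supported on [G], so [G] certifies both signs for [stress_eq0];
    each edge occurs in [G] in one orientation only, which isolates its coefficient. *)
Lemma indep_full G : pointed_noncrossing P G -> indep crow (full G).
Proof.
move=> pG l l0.
pose l' k := if k \in full G then l k else 0.
have l'0 : \sum_k l' k *: crow k = 0.
  rewrite -[RHS]l0 [RHS]big_mkcond; apply: eq_bigr => k _.
  by rewrite /l'; case: ifP => // _; rewrite scale0r.
have [lt ws] := comb_relation l'0.
have l'G i j : (i, j) \notin G -> l' (inr (i, j)) = 0.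
  by rewrite /l' inE => /negPf ->.
have wG i j : l' (inr (i, j)) + l' (inr (j, i)) != 0 -> adjacent G i j.
  rewrite /adjacent; have [|/l'G ->] := boolP ((i, j) \in G); first by left.
  have [|/l'G ->] := boolP ((j, i) \in G); first by right.
  by rewrite addr0 eqxx.
have w0 : forall i j, i != j -> l' (inr (i, j)) + l' (inr (j, i)) = 0.
  apply: (stress_eq0 n3 gp ws); apply: (neg_pointed_noncrossing_of_graph pG) => i j _ h.
    by apply: wG; rewrite lt_eqF.
  by apply: wG; rewrite -oppr_eq0 lt_eqF.
move=> k kG; have <- : l' k = l k by rewrite /l' kG.
case: k kG => [t _|[i j]]; first exact: lt.
rewrite inE => eG; have /= ij := pG.1 _ eG.
have := w0 i j; rewrite neq_ltn ij => /(_ isT); rewrite [l' (inr (j, i))]l'G ?addr0 //.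
by apply/negP => /(pG.1) /=; rewrite ltnNge ltnW.
Qed.

Lemma tight_graph_pnc v : Xbar P f v -> pointed_noncrossing P (tight_graph v).
Proof.
move=> Xv; apply: (tight_graph_pointed_noncrossing n3 gp Xv) => e.
by rewrite inE => /andP[e12 /eqP].
Qed.

Lemma nondegenerate x : Xpoly x -> indep crow (tset x).
Proof.
by move=> /poly_Xbar Xx; rewrite tightset_full; apply/indep_full/tight_graph_pnc.
Qed.

(** A dilation about [P i0] expands every pair; its factor [t] dominates all ratios of [f] to
    squared length. The rotation of speed [o] changes no length and restores the normalisation at
    [i1]. *)
Lemma Xbar_nonempty : exists v, Xbar P f v.
Proof.
pose N (e : 'I_n * 'I_n) := dotp (ptsub (P e.1) (P e.2)) (ptsub (P e.1) (P e.2)).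
have N_ge0 e : 0 <= N e by rewrite /N /dotp -!expr2 addr_ge0 ?sqr_ge0.
pose t := \sum_e `|f e.1 e.2| / N e.
pose o := t * ((P i1).1 - (P i0).1) / ((P i1).2 - (P i0).2).
exists (fun k => (t * ((P k).1 - (P i0).1) - o * ((P k).2 - (P i0).2),
                  t * ((P k).2 - (P i0).2) + o * ((P k).1 - (P i0).1))).
split.
  move=> i; split=> vi.
    have -> : i = i0 by exact: val_inj.
    by rewrite /= !subrr !mulr0 subrr addr0.
  have -> : i = i1 by exact: val_inj.
  by rewrite /o /= divfK ?subrr // subr_eq0 eq_sym y01.
move=> i j ij.
have -> : dotp (ptsub (P i) (P j)) (ptsub
   (t * ((P i).1 - (P i0).1) - o * ((P i).2 - (P i0).2),
    t * ((P i).2 - (P i0).2) + o * ((P i).1 - (P i0).1))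
   (t * ((P j).1 - (P i0).1) - o * ((P j).2 - (P i0).2),
    t * ((P j).2 - (P i0).2) + o * ((P j).1 - (P i0).1))) = t * N (i, j).
  by rewrite /N /dotp /ptsub /=; ring.
have Nij : 0 < N (i, j).
  have ji : j != i by rewrite neq_ltn ij orbT.
  exact: sqnorm_gt0 (P_inj n3 gp ji).
apply: le_trans (ler_norm _) _; rewrite -ler_pdivrMr // /t (bigD1 (i, j)) //=.
by rewrite lerDl sumr_ge0 // => e _; rewrite divr_ge0.
Qed.

Lemma realize_graph G : pointed_noncrossing P G ->
  exists2 v, Xbar P f v & tight_graph v = G.
Proof.
move=> pG; have [v0 Xv0] := Xbar_nonempty.
pose G' : {set constraint} := [set k : constraint | if k is inr e then e \in G else false].
pose c := \sum_(k in G') 1 *: crow k.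
have cbd x : Xpoly x -> \sum_(k in G') rhs k <= pairing c x.
  move=> px; rewrite /c pairing_suml; apply: ler_sum => -[t|e]; rewrite inE // => eG.
  by rewrite mul1r; apply: px.2; rewrite inE (pG.1 _ eG).
have pv0 : Xpoly (enc v0) by apply/poly_Xbar; rewrite encK.
have [x [l [px cl lpos]]] := lp_optimum pv0 nondegenerate cbd.
pose lx k := if k \in tset x then l k else 0.
pose m k := (k \in G')%:R - lx k.
have m0 : \sum_k m k *: crow k = 0.
  under eq_bigr do rewrite scalerBl.
  rewrite sumrB; apply/eqP; rewrite subr_eq0; apply/eqP.
  transitivity c.
    rewrite /c [RHS]big_mkcond; apply: eq_bigr => k _.
    by case: ifP; rewrite ?scale0r.
  rewrite cl [LHS]big_mkcond; apply: eq_bigr => k _.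
  by rewrite /lx; case: ifP; rewrite ?scale0r.
have [_ ws] := comb_relation m0.
have G'E i j : (inr (i, j) \in G') = ((i, j) \in G) by rewrite inE.
have lx0 i j : 0 <= lx (inr (i, j)).
  by rewrite /lx; case: ifP => // kT; apply: lpos; rewrite // inE.
have lxT i j : (i, j) \notin tight_graph (dec x) -> lx (inr (i, j)) = 0.
  by move=> /negPf h; rewrite /lx tightset_full [_ \in full _]inE h.
(* Negative weights need a positive multiplier, hence a tight edge of the optimum; positive weights
   need an edge of [G]. *)
have w0 : forall i j, i != j -> m (inr (i, j)) + m (inr (j, i)) = 0.
  apply: (stress_eq0 n3 gp ws).
    apply: (neg_pointed_noncrossing_of_graph
      (tight_graph_pnc ((poly_Xbar x).1 px))) => i j _.
    rewrite /adjacent; have [|/lxT E1] := boolP ((i, j) \in tight_graph _); first by left.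
    have [|/lxT E2] := boolP ((j, i) \in tight_graph _); first by right.
    by rewrite /m E1 E2 !subr0 ltNge addr_ge0.
  apply: (neg_pointed_noncrossing_of_graph pG) => i j _.
  rewrite /adjacent /m !G'E.
  case: ((i, j) \in G); first by left.
  case: ((j, i) \in G); first by right.
  by rewrite !sub0r -opprD opprK ltNge addr_ge0.
(* A loose edge of [G] has multiplier 0, so it would carry weight at least 1 in the vanishing
   stress. *)
have GT : G \subset tight_graph (dec x).
  apply/subsetP => -[i j] eG; have /= ij := pG.1 _ eG.
  apply: contraT => /lxT E1.
  have := w0 i j; rewrite neq_ltn ij => /(_ isT); rewrite /m E1 !G'E eG subr0.
  rewrite lxT ?subr0; last by rewrite inE /= ltnNge ltnW.
  by move/eqP; rewrite -natrD pnatr_eq0.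
have [||y py yT] := @drop_tight _ _ _ crow rhs Eqs Ineqs x (full G) px (nondegenerate px).
- by apply/subsetP => -[t|e]; rewrite !inE.
- by rewrite tightset_full fullS.
exists (dec y); first exact/poly_Xbar.
apply/eqP; rewrite eqEsubset -!fullS -tightset_full yT.
by rewrite subxx.
Qed.

(** * Faces and their tight graphs *)

Definition graph_face (G : {set 'I_n * 'I_n}) (v : motion R n) : Prop :=
  Xbar P f v /\ G \subset tight_graph v.

Lemma tight_graphP v e : Xbar P f v ->
  (e \in tight_graph v) = (e.1 < e.2)%N && `[< tight P f e.1 e.2 v >].
Proof.
by move=> Xv; rewrite inE; congr (_ && _); apply/eqP/asboolP.
Qed.

Lemma sub_EofP (K : motion R n -> Prop) v : (forall u, K u -> Xbar P f u) ->
  K v -> Eof P f K \subset tight_graph v.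
Proof.
move=> KX Kv; apply/subsetP => e; rewrite inE => /andP[e12 /asboolP eT].
by rewrite (tight_graphP _ (KX v Kv)) e12; apply/asboolP/eT.
Qed.

Lemma face_graph_face G : graph_wf G -> face (Xbar P f) (graph_face G).
Proof.
move=> wG; pose c := \sum_(k in full G) 1 *: crow k.
have EG : Eqs \subset full G by apply/subsetP => -[t|e]; rewrite !inE.
have GD : full G \subset Eqs :|: Ineqs.
  by apply/subsetP => -[t|e]; rewrite !inE // => /wG.
have linE v : lin (dec c^T) v = pairing c (enc v).
  by rewrite -{2}(trmxK c) -(decK c^T) pairing_enc decK encK.
have pX v : Xbar P f v -> Xpoly (enc v) by move=> Xv; apply/poly_Xbar; rewrite encK.
exists (dec c^T), (\sum_(k in full G) rhs k); split=> v.
  by move=> /pX /(tight_face EG GD) [h _]; rewrite linE.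
rewrite linE; split=> -[Xv h]; split=> //.
  by apply/(tight_face EG GD (pX v Xv)).2; rewrite tightset_full encK fullS.
by have := (tight_face EG GD (pX v Xv)).2.1 h; rewrite tightset_full encK fullS.
Qed.

(** The motion realising [G] is tight on nothing else, which rules out further common tight
    edges. *)
Lemma Eof_graph_face G : pointed_noncrossing P G -> Eof P f (graph_face G) = G.
Proof.
move=> pG; have [v Xv vG] := realize_graph pG.
apply/eqP; rewrite eqEsubset; apply/andP; split.
  rewrite -{2}vG; apply: sub_EofP; first by move=> u [].
  by split=> //; rewrite vG.
apply/subsetP => e eG; rewrite inE (pG.1 _ eG); apply/asboolP => u [Xu /subsetP /(_ e eG)].
by rewrite tight_graphP // => /andP[_ /asboolP].
Qed.

(** At a relative interior point the tight edges are exactly those common to the face, and by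
    [face_tight] they determine it. *)
Lemma face_interior_graph K : face (Xbar P f) K -> nonempty K ->
  exists v0, [/\ K v0, tight_graph v0 = Eof P f K &
    forall v, K v <-> graph_face (Eof P f K) v].
Proof.
case=> c [delta [cX KE]] [v Kv].
have linE x : lin c (dec x) = pairing (enc c)^T x by rewrite pairing_enc.
have cm x : Xpoly x -> delta <= pairing (enc c)^T x.
  by move=> /poly_Xbar /cX; rewrite linE.
have [Xv cv] := (KE v).1 Kv.
have KX u : K u -> Xbar P f u by move=> /KE[].
have [||x0 [p0 c0 T0]] := @face_interior _ _ _ crow rhs Eqs Ineqs (enc c)^T delta (enc v).
- by apply/poly_Xbar; rewrite encK.
- by rewrite -linE encK.
have K0 : K (dec x0) by apply/KE; rewrite linE; split=> //; apply/poly_Xbar.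
have E0 : tight_graph (dec x0) = Eof P f K.
  apply/eqP; rewrite eqEsubset; apply/andP; split; last exact: sub_EofP.
  apply/subsetP => e eT; have := eT; rewrite inE => /andP[e12 _].
  rewrite inE e12; apply/asboolP => u Ku; have [Xu cu] := (KE u).1 Ku.
  have sub : tight_graph (dec x0) \subset tight_graph u.
    rewrite -fullS -(encK u) -!tightset_full; apply: T0.
      by apply/poly_Xbar; rewrite encK.
    by rewrite -linE encK.
  by have := subsetP sub e eT; rewrite tight_graphP // => /andP[_ /asboolP].
exists (dec x0); split=> // u; split=> [Ku|[Xu uT]].
  by split; [exact: KX | exact: sub_EofP].
apply/KE; split=> //; rewrite -[u]encK linE.
apply: (face_tight cm p0 c0); first by apply/poly_Xbar; rewrite encK.
by rewrite !tightset_full fullS encK E0.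
Qed.

Lemma face_eq K : face (Xbar P f) K -> nonempty K -> K = graph_face (Eof P f K).
Proof.
move=> fK nK; have [_ [_ _ h]] := face_interior_graph fK nK.
by apply/funext => v; apply/propext.
Qed.

Lemma Eof_pnc K : face (Xbar P f) K -> nonempty K -> pointed_noncrossing P (Eof P f K).
Proof.
move=> fK nK; have [v [Kv <- h]] := face_interior_graph fK nK.
exact/tight_graph_pnc/((h v).1 Kv).1.
Qed.

(** The [3 + #|G|] rows of [full G] are independent, and a motion tight on exactly these rows
    exists. *)
Lemma affdim_graph_face G : pointed_noncrossing P G ->
  affdim (graph_face G) (2 * n - 3 - #|G|).
Proof.
move=> pG; have dimE : (2 * n - 3 - #|G| = n + n - #|full G|)%N by rewrite card_full; lia.
rewrite dimE; split.
  have [v Xv vG] := realize_graph pG.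
  have pv : Xpoly (enc v) by apply/poly_Xbar; rewrite encK.
  have := face_dim_ge pv (nondegenerate pv).
  rewrite tightset_full encK vG => -[y [yP yf]].
  exists (fun l => dec (y l)); split; last exact/aff_indep_dec.
  by move=> l; have [/poly_Xbar Xl] := yP l; rewrite tightset_full fullS.
case=> x [xG xf]; apply: (@face_dim_le _ _ _ crow rhs (full G) (fun l => enc (x l))).
- exact: indep_full.
- move=> l k kG; have [Xl Gl] := xG l.
  have pl : Xpoly (enc (x l)) by apply/poly_Xbar; rewrite encK.
  by apply: (tightP pl); rewrite tightset_full encK (subsetP _ _ kG) ?fullS.
- apply/aff_indep_dec; move: xf; congr aff_indep.
  by apply/funext => l; rewrite encK.
Qed.

(** There are [3 + #|G|] independent rows in dimension [2 n]. With this bound the truncated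
    subtraction in the dimension formula loses nothing. *)
Lemma card_pnc G : pointed_noncrossing P G -> (#|G| <= 2 * n - 3)%N.
Proof.
move=> /indep_full /rank_cols E.
by have := rank_leq_row (cols crow (full G)); rewrite E card_full; lia.
Qed.

Lemma pnc_sub (G G' : {set 'I_n * 'I_n}) :
  pointed_noncrossing P G -> G' \subset G -> pointed_noncrossing P G'.
Proof.
move=> [wG [nG pG]] /subsetP s; split; first by move=> e /s /wG.
split; first by move=> e e' /s eG /s e'G; apply: nG.
by move=> i; have [u uP] := pG i; exists u => j [/s h|/s h]; apply: uP; [left | right].
Qed.

Lemma nonempty_affdim (S : motion R n -> Prop) d : affdim S d -> nonempty S.
Proof. by case=> [[x [xS _]] _]; exists (x ord0). Qed.

Lemma subset_faceP K K' : face (Xbar P f) K -> nonempty K ->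
  face (Xbar P f) K' -> nonempty K' ->
  (subset_m K K' <-> Eof P f K' \subset Eof P f K).
Proof.
move=> fK nK fK' nK'; split=> [KK|EE v].
  apply/subsetP => e; rewrite !inE => /andP[-> /asboolP h]; apply/asboolP => v /KK.
  exact: h.
rewrite (face_eq fK nK) => -[Xv vK]; rewrite (face_eq fK' nK'); split=> //.
exact: subset_trans vK.
Qed.

Lemma Xbar_valid : valid P f.
Proof.
split; first exact: Eof_pnc.
split; last exact: subset_faceP.
move=> G pG; exists (graph_face G); split; first exact: face_graph_face pG.1.
split; last exact: Eof_graph_face.
exact: nonempty_affdim (affdim_graph_face pG).
Qed.

(** A vertex has [2 n - 3] tight edges by the dimension formula, and every subset of them is again
    pointed and non-crossing; the facets through it are the faces of its single edges. *)
Lemma Xbar_simple : simple_polyhedron (Xbar P f) (2 * n - 3).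
Proof.
split.
  have [v Xv] := Xbar_nonempty.
  have p0 : pointed_noncrossing P set0 by apply: pnc_sub (tight_graph_pnc Xv) (sub0set _).
  have := affdim_graph_face p0; rewrite cards0 subn0.
  suff -> : graph_face set0 = Xbar P f by [].
  by apply/funext => u; apply/propext; split=> [[]//|Xu]; split=> //; exact: sub0set.
move=> V fV dV; have nV := nonempty_affdim dV.
have pV := Eof_pnc fV nV; set G := Eof P f V in pV.
have VE : V = graph_face G := face_eq fV nV.
have cardG : (2 * n - 3 = #|G|)%N.
  have := affdim_uniq dV; rewrite VE => /(_ _ (affdim_graph_face pV)).
  by have := card_pnc pV; lia.
pose e l : 'I_n * 'I_n := enum_val (cast_ord cardG l).
have eG l : e l \in G by exact: enum_valP.
have pe x : x \in G -> pointed_noncrossing P [set x].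
  by move=> xG; apply: pnc_sub pV _; rewrite sub1set.
exists (fun l => graph_face [set e l]); split.
  move=> l l' /(congr1 (Eof P f)); rewrite !Eof_graph_face; [|exact: pe..].
  by move=> /set1_inj /enum_val_inj /cast_ord_inj.
move=> F; split=> [[fF [dF VF]]|[l ->]].
  have nF := nonempty_affdim dF; have pF := Eof_pnc fF nF.
  have FE := face_eq fF nF; have FG := (subset_faceP fV nV fF nF).1 VF.
  (* Codimension one means a single tight edge. *)
  have /eqP/cards1P [x xE] : #|Eof P f F| = 1%N.
    have := affdim_uniq dF; rewrite {1}FE => /(_ _ (affdim_graph_face pF)).
    by have := card_pnc pF; lia.
  have xG : x \in G by rewrite -sub1set -xE.
  exists (cast_ord (esym cardG) (enum_rank_in xG x)).
  by rewrite FE xE /e cast_ordKV enum_rankK_in.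
split; first exact: face_graph_face (pe _ (eG l)).1.
split; last by rewrite VE => v [Xv vG]; split=> //; rewrite sub1set (subsetP vG).
by have := affdim_graph_face (pe _ (eG l)); rewrite cards1 subn1.
Qed.

End Expansion.

Unset Implicit Arguments.

Theorem theorem3p9 (R : realType) (a b : pt R) (n : nat) (P : 'I_n -> pt R) :
  (3 <= n)%N ->
  general_position P ->
  (forall i j : 'I_n, val i = 0%N -> val j = 1%N -> (P i).2 != (P j).2) ->
  let f := fun i j : 'I_n => det3 a (P i) (P j) * det3 b (P i) (P j) in
  simple_polyhedron (Xbar P f) (2 * n - 3) /\ valid P f.
Proof.
by move=> n3 gp y01 f; split; [exact: Xbar_simple | exact: Xbar_valid].
Qed.
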